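(* Let $Q$ be in the Frobenius normal form described in the context, let $(X_i)$ be the associated absorbed Markov chain with initial distribution $\pi$ and absorption time $T$, and assume: (A1) for all $i\in\{1,\dots,k\}$ with $\rho_i<\rho_{\max}$, the diagonal block $Q_{ii}$ is scalar; (A2) there is $\theta\in\mathcal{P}_{\max}$ with $\alpha_\theta\neq0$ and $\pi_{\theta_1}v_{\theta_1}\neq0$. Let $\ell\in\{1,\dots,k\}$ with $\rho_\ell=\rho_{\max}$ and $\mathcal{P}^{(\ell)}_{\max}\neq\emptyset$. Then for all $s\in I_\ell$, with $t(s):=s-\sum_{i=1}^{\ell-1}d_i$, \[ \lim_{n\to\infty}\mathbb{E}_\pi\Big[\tfrac{1}{n+1}\#\{m\in\{0,\dots,n\}:X_m=s\}\,\Big|\,T>n\Big]=u^{(\ell)}_{t(s)}v^{(\ell)}_{t(s)}\,\frac{1}{h^+_{\max}}\,\frac{\sum_{\theta\in\mathcal{P}^{(\ell)}_{\max}}\alpha_\theta\pi_{\theta_1}v_{\theta_1}\prod_{u\in H^-(\theta)}\frac{1}{\rho_{\max}-\rho_{\theta_u}}}{\sum_{\theta\in\mathcal{P}_{\max}}\alpha_\theta\pi_{\theta_1}v_{\theta_1}\prod_{u\in H^-(\theta)}\frac{1}{\rho_{\max}-\rho_{\theta_u}}}, \] where $u^{(\ell)\top}=(u^{(\ell)}_1,\dots,u^{(\ell)}_{d_\ell})$ and $v^{(\ell)}=(v^{(\ell)}_1,\dots,v^{(\ell)}_{d_\ell})^\top$ are the positive left and right eigenvectors of $Q_{\ell\ell}$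 for $\rho_\ell$ normalised by $\sum_{i=1}^{d_\ell}v^{(\ell)}_i=1$ and $u^{(\ell)\top}v^{(\ell)}=1$.
   Context: Let $d\ge2$, $P=\begin{pmatrix}1&0\\R&Q\end{pmatrix}$ a stochastic $(d+1)\times(d+1)$ matrix with $R\in\mathbb{R}^{d\times1}$, $Q\in\mathbb{R}^{d\times d}$, $R,Q\ne0$, all eigenvalues of $Q$ of modulus $<1$. $(X_i)_{i\in\mathbb{N}_0}$ is the Markov chain with transition matrix $P$ (state $0$ absorbing), initial distribution $\pi$ on $\{1,\dots,d\}$, $T=\min\{i:X_i=0\}$. $Q$ is in Frobenius normal form: block lower triangular with blocks $Q_{ij}\in\mathbb{R}^{d_i\times d_j}$, $i,j\in\{1,\dots,k\}$, $Q_{ij}=0$ for $j>i$, each $Q_{ii}$ eventually positive with Perron--Frobenius eigenvalue $\rho_i$; $I_j=\{1+\sum_{i<j}d_i,\dots,\sum_{i\le j}d_i\}$; $\pi=(\pi_1,\dots,\pi_k)$ with $\pi_i\in\mathbb{R}^{1\times d_i}$. $v_i$ is a fixed normed positive right eigenvector of $Q_{ii}$ for $\rho_i$ ($v_i=1$ if $d_i=1$), $V_i^-$ the sum of the generalised eigenspaces of $Q_{ii}$ for its other eigenvalues. Admissible path: strictly decreasing $\theta=(\theta_1,\dots,\theta_\kappa)$ in $\{1,\dots,k\}$ with $Q_{\theta_u\theta_{u+1}}\ne0$ for $u<\kappa$; $\mathcal{P}$ the set of them, $\mathcal{P}^{(\ell)}$ those containing $\ell$. $\rho(\theta)=\max_u\rho_{\theta_u}$,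 $H^+(\theta)=\{u:\rho_{\theta_u}=\rho(\theta)\}$, $H^-(\theta)=\{u:\rho_{\theta_u}<\rho(\theta)\}$, $h^+(\theta)=\#H^+(\theta)$. $\rho_{\max}=\max_i\rho_i$, $h^+_{\max}=\max\{h^+(\theta):\theta\in\mathcal{P},\rho(\theta)=\rho_{\max}\}$, $\mathcal{P}_{\max}=\{\theta\in\mathcal{P}:h^+(\theta)=h^+_{\max},\rho(\theta)=\rho_{\max}\}$, $\mathcal{P}^{(\ell)}_{\max}=\mathcal{P}^{(\ell)}\cap\mathcal{P}_{\max}$. $\alpha_\theta=\alpha_{\theta_\kappa}\cdots\alpha_{\theta_1}$, where $\mathbf1=\alpha_{\theta_\kappa}v_{\theta_\kappa}+w_{\theta_\kappa}$ with $w_{\theta_\kappa}\in V^-_{\theta_\kappa}$ ($\mathbf1$ all-ones) and, for $u=\kappa-1,\dots,1$, $Q_{\theta_u\theta_{u+1}}v_{\theta_{u+1}}=\alpha_{\theta_u}v_{\theta_u}+w_{\theta_u}$ with $w_{\theta_u}\in V^-_{\theta_u}$. *)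

(* Defs.v *)
From HB Require Import structures.
From mathcomp Require Import all_boot all_order all_algebra.
From mathcomp Require Import all_classical all_reals all_analysis.
From mathcomp Require Import complex.
Set Implicit Arguments. Unset Strict Implicit. Unset Printing Implicit Defensive.
Import Order.TTheory GRing.Theory Num.Theory.
Local Open Scope ring_scope.

Section Defs.
Variable R : realType.
Local Notation C := R[i].

Definition cplx_mx m n (A : 'M[R]_(m, n)) : 'M[C]_(m, n) :=
  map_mx (fun x => (x%:C)%C) A.

Definition is_eigenvalue n (A : 'M[R]_n) (lam : C) : Prop :=
  exists x : 'cV[C]_n, x != 0 /\ cplx_mx A *m x = lam *: x.

(* V^-: the sum of the generalised eigenspaces ker (A - lam)^n of A for the
   (complex) eigenvalues lam different from rho; a real vector w lies in V^-
   iff its complexification is such a (finite) sum. *)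
Definition Vminus n (A : 'M[R]_n) (rho : R) (w : 'cV[R]_n) : Prop :=
  exists (m : nat) (lam : 'I_m -> C) (ws : 'I_m -> 'cV[C]_n),
    (forall j, lam j != (rho%:C)%C /\ (cplx_mx A - (lam j)%:M) ^+ n *m ws j = 0)
    /\ cplx_mx w = \sum_(j < m) ws j.

(* --- block structure: blk s is the index of the diagonal block containing s *)
Variables (d k : nat) (blk : 'I_d -> 'I_k).

Definition Iset (i : 'I_k) : {set 'I_d} := [set s | blk s == i].

(* block Q_ij of Q, rows/columns of I_i enumerated increasingly *)
Definition Qblk (Q : 'M[R]_d) (i j : 'I_k) : 'M[R]_(#|Iset i|, #|Iset j|) :=
  \matrix_(a, b) Q (enum_val a) (enum_val b).

Definition pi_v (pi : 'I_d -> R) (i : 'I_k) (x : 'cV[R]_(#|Iset i|)) : R :=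
  \sum_(a < #|Iset i|) pi (enum_val a) * x a 0.

Variables (Q : 'M[R]_d) (rho : 'I_k -> R)
          (v : forall i : 'I_k, 'cV[R]_(#|Iset i|)).

Definition alpha_blk (i : 'I_k) (x : 'cV[R]_(#|Iset i|)) : R :=
  xget 0 [set a : R | Vminus (Qblk Q i i) (rho i) (x - a *: v i)].

Fixpoint alpha_path (th : seq 'I_k) : R :=
  match th with
  | [::] => 1
  | [:: i] => @alpha_blk i (const_mx 1)
  | i :: ((j :: _) as th') =>
      @alpha_blk i (Qblk Q i j *m v j) * alpha_path th'
  end.

(* strictly decreasing sequences in {1..k}: one for each nonempty set *)
Definition dec_seqs : seq (seq 'I_k) :=
  [seq rev (enum A) | A : {set 'I_k} <- enum {set 'I_k} & (0 < #|A|)%N].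

Fixpoint admissible_links (th : seq 'I_k) : bool :=
  match th with
  | i :: ((j :: _) as th') => (Qblk Q i j != 0) && admissible_links th'
  | _ => true
  end.

Definition adm_paths : seq (seq 'I_k) := [seq th <- dec_seqs | admissible_links th].

Definition rho_path (th : seq 'I_k) : R := \big[Num.max/0]_(i <- th) rho i.
Definition hplus (th : seq 'I_k) : nat := count (fun i => rho i == rho_path th) th.
Definition rho_max : R := \big[Num.max/0]_(i < k) rho i.
Definition hplus_max : nat :=
  \max_(th <- adm_paths | rho_path th == rho_max) hplus th.
Definition Pmax : seq (seq 'I_k) :=
  [seq th <- adm_paths | (hplus th == hplus_max) && (rho_path th == rho_max)].
Definition Pmax_l (l : 'I_k) : seq (seq 'I_k) := [seq th <- Pmax | l \in th].

Definition Hminus_prod (th : seq 'I_k) : R :=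
  \prod_(i <- th | rho i < rho_path th) (rho_max - rho i)^-1.

Definition path_weight (pi : 'I_d -> R) (th : seq 'I_k) : R :=
  match th with
  | [::] => 0
  | i1 :: _ => alpha_path th * @pi_v pi i1 (v i1) * Hminus_prod th
  end.
End Defs.

(* --- the absorbed Markov chain on {0,...,d} (state 0 = ord0 absorbing,
   state s in {1..d} is lift ord0 s' for s' : 'I_d), transition matrix P,
   initial distribution pi on {1..d}. *)
Section Chain.
Variables (R : realType) (d : nat) (P : 'M[R]_d.+1) (pi : 'I_d -> R).

Definition init_law (x : 'I_d.+1) : R :=
  match unlift ord0 x with Some s => pi s | None => 0 end.

Definition path_prob (n : nat) (x : {ffun 'I_n.+1 -> 'I_d.+1}) : R :=
  init_law (x ord0) *
  \prod_(m < n) P (x (widen_ord (leqnSn n) m)) (x (lift ord0 m)).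

Definition not_absorbed (n : nat) (x : {ffun 'I_n.+1 -> 'I_d.+1}) : bool :=
  [forall m, x m != ord0].

Definition occupation (n : nat) (x : {ffun 'I_n.+1 -> 'I_d.+1}) (s : 'I_d.+1) : nat :=
  #|[set m | x m == s]|.

Definition cond_occupation (s : 'I_d.+1) (n : nat) : R :=
  (\sum_(x : {ffun 'I_n.+1 -> 'I_d.+1} | not_absorbed x)
      path_prob x * ((occupation x s)%:R / n.+1%:R))
  / (\sum_(x : {ffun 'I_n.+1 -> 'I_d.+1} | not_absorbed x) path_prob x).
End Chain.

(* P = [[1, 0], [R, Q]] : the transient block Q and the absorption column R *)
Definition Qof (R : realType) (d : nat) (P : 'M[R]_d.+1) : 'M[R]_d :=
  \matrix_(i, j) P (lift ord0 i) (lift ord0 j).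
Definition Rof (R : realType) (d : nat) (P : 'M[R]_d.+1) : 'cV[R]_d :=
  \col_i P (lift ord0 i) ord0.

(* Main.v *)
(* The numerator and the denominator of the conditional expectation are
     sum_(m <= n) (pi Q^m)_s (Q^(n-m) 1)_s   and   pi Q^n 1.
   Expanding both along decreasing paths of blocks writes them as sums of iterated convolutions of
   the kernels Q_ii^n / rho_max^(n+1).  By Perron-Frobenius such a kernel is rho_max^-1 v_i u_i plus
   a summable sequence when rho_i = rho_max; otherwise, by (A1), it is a scalar geometric sequence of
   sum 1 / (rho_max - rho_i).  Convolution with a kernel of the first kind raises the order of
   polynomial growth by one, and with one of the second kind it only multiplies the leading constant
   by the sum.  A path theta thus contributes growth n^(h^+(theta) - 1) to the denominator, whereas in
   the numerator the kernel of block l is used twice, before and after the visit to s, which gives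
   n^(h^+(theta)); hence only the paths in P_max survive, and the quotient of the two binomial
   normalisations gives the factor 1 / h^+_max.  All path weights are nonnegative, so (A2) says
   exactly that the limit of the denominator is nonzero. *)
Require Import Defs.
From HB Require Import structures.
From mathcomp Require Import all_boot all_order all_algebra.
From mathcomp Require Import all_classical all_reals all_analysis.
From mathcomp Require Import complex.
From mathcomp Require Import ring.
Import Order.TTheory GRing.Theory Num.Theory.
Import numFieldNormedType.Exports.
Local Open Scope classical_set_scope.
Local Open Scope ring_scope.
Set Implicit Arguments.
Unset Strict Implicit.
Unset Printing Implicit Defensive.

(** * Growth orders of sequences and their convolutions *)

Section Sequences.
Context {R : realType}.
Implicit Types (f g : nat -> R) (c e : R) (h n : nat).

(** Both scaled sequences solve a recursion rho y_(n+1) = Q y_n + f_(n+1) with rho = rho_max. For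
    the occupation counts the source f is rho times the tail vector restricted to the state s, and
    this is itself a sum over paths; hence sources are attached to paths and not only to blocks. The
    summable error of the top kernels comes from a contraction in the norm weighted by v_i, without
    any Jordan form. The coefficients alpha_theta are defined through spectral complements, which
    show neither their sign nor their link with the kernels. The bridge is that V_i^- is the kernel
    of the left Perron eigenvector u_i, so that alpha_theta is a product of numbers u_i x with x
    nonnegative. *)

Lemma cvg_ext f g c : f =1 g -> f @ \oo --> c -> g @ \oo --> c.
Proof. by move=> /funext ->. Qed.

Lemma cvgDn f g c e : f @ \oo --> c -> g @ \oo --> e -> (fun n => f n + g n) @ \oo --> c + e.
Proof. exact: cvgD. Qed.

Lemma cvgMn f g c e : f @ \oo --> c -> g @ \oo --> e -> (fun n => f n * g n) @ \oo --> c * e.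
Proof. exact: cvgM. Qed.

Lemma cvg_big_sum (I : Type) (r : seq I) (P : pred I) (f : I -> nat -> R) (c : I -> R) :
  (forall i, P i -> f i @ \oo --> c i) ->
  (fun n => \sum_(i <- r | P i) f i n) @ \oo --> \sum_(i <- r | P i) c i.
Proof.
move=> fc; elim: r => [|i r IH].
  by rewrite big_nil; apply: (cvg_ext _ (cvg_cst _)) => n; rewrite big_nil.
rewrite big_cons; case: ifPn => Pi; last first.
  by apply: (cvg_ext _ IH) => n; rewrite big_cons (negbTE Pi).
by apply: (cvg_ext _ (cvgDn (fc _ Pi) IH)) => n; rewrite big_cons Pi.
Qed.

Definition asummable f := cvgn (series (fun n => `|f n|)).

Lemma bounded_asummable f (K : R) :
  (forall n, series (fun n => `|f n|) n <= K) -> asummable f.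
Proof.
move=> fK; apply: nondecreasing_is_cvgn.
  by apply: nondecreasing_series => n _ _; exact: normr_ge0.
by exists K => _ [n _ <-].
Qed.

Lemma asummable_le f g : (forall n, `|f n| <= `|g n|) -> asummable g -> asummable f.
Proof.
move=> fg; apply: series_le_cvg => // n; exact: normr_ge0.
Qed.

Lemma cvg_bounded f c : f @ \oo --> c -> exists M, 0 <= M /\ forall n, `|f n| <= M.
Proof.
move=> fc; have /cvg_seq_bounded [M [Mr MP]] : cvgn f by apply/cvg_ex; exists c.
exists (`|M| + 1); split=> [|n]; first by rewrite addr_ge0.
by apply: (MP (`|M| + 1)) => //; apply: (le_lt_trans (ler_norm M)); rewrite ltrDl.
Qed.

(** Dominated convergence for series: beyond a fixed index the sum is small uniformly in [n] because
    the weights are bounded, and the finitely many remaining terms converge one by one. *)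
Lemma tannery (w : nat -> nat -> R) (M c e : R) g :
  (forall n i, (i <= n)%N -> `|w n i| <= M) ->
  (forall i, w ^~ i @ \oo --> c) ->
  asummable g -> series g @ \oo --> e ->
  (fun n => \sum_(i < n.+1) w n i * g i) @ \oo --> c * e.
Proof.
move=> wM wc sg ge.
have gS : (fun n => c * series g n.+1) @ \oo --> c * e.
  by apply: cvgMl_tmp; rewrite (cvg_shiftS (series g)).
suff d0 : (fun n => \sum_(i < n.+1) (w n i - c) * g i) @ \oo --> (0 : R).
  rewrite -[X in _ --> X]add0r; apply: (cvg_ext _ (cvgDn d0 gS)) => n; rewrite ?fctE /series /= big_mkord mulr_sumr -big_split /=.
  by apply: eq_bigr => i _; ring.
set G := limn (series (fun n => `|g n|)).
have M0 : 0 <= M by apply: le_trans (wM 0 0 _)%N.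
have Gn n : series (fun n => `|g n|) n <= G.
  by apply: (nondecreasing_cvgn_le (nondecreasing_series (P:=xpredT) (fun n _ _ => normr_ge0 (g n)))).
apply/cvgrPdist_le => eps eps0.
have K0 : 0 < M + `|c| + 1 by rewrite ltr_wpDl // addr_ge0.
(* The cut-off: [M + |c|] bounds [|w n i - c|], and the added 1 makes the bound positive, so that it
   can be divided by. *)
have [N _ NP] : \forall N \near \oo, (M + `|c| + 1) * (G - series (fun n => `|g n|) N) <= eps / 2.
  have : (fun N => series (fun n => `|g n|) N) @ \oo --> G by exact: sg.
  move/cvgrPdist_le => /(_ (eps / 2 / (M + `|c| + 1))) H.
  near=> N; rewrite mulrC -ler_pdivlMr //.
  by apply: le_trans (ler_norm _) _; near: N; apply: H; rewrite divr_gt0 ?divr_gt0.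
have /cvgrPdist_le /(_ (eps / 2)) : (fun n => \sum_(i < N) `|w n i - c| * `|g i|) @ \oo --> (0 : R).
  rewrite [X in _ --> X](_ : 0 = \sum_(i < N) (0 : R)); last by rewrite big1.
  apply: cvg_big_sum => i _; rewrite -[X in _ --> X](mul0r `|g i|); apply: cvgMl.
  rewrite -[X in _ --> X](normr0 R); apply: cvg_norm; rewrite -[X in _ --> X](subrr c).
  by apply: cvgB => //; exact: cvg_cst.
rewrite divr_gt0 // => /(_ isT) HN.
near=> n; rewrite sub0r normrN.
have Nn : (N <= n.+1)%N by near: n; exists N => // m /= /leqW.
apply: le_trans (ler_norm_sum _ _ _) _.
rewrite -(big_mkord xpredT (fun i => `|(w n i - c) * g i|)) (big_cat_nat (leq0n N) Nn) //=.
rewrite (splitr eps); apply: lerD.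
  have : `|0 - \sum_(i < N) `|w n i - c| * `|g i| | <= eps / 2 by near: n; exact: HN.
  rewrite sub0r normrN => /(le_trans (ler_norm _)); apply: le_trans.
  by rewrite big_mkord; apply: ler_sum => i _; rewrite normrM.
apply: le_trans (NP N _) => //=.
apply: (@le_trans _ _ ((M + `|c| + 1) * \sum_(N <= i < n.+1) `|g i|)).
  rewrite mulr_sumr; apply: ler_sum_nat => i /andP[Ni iN]; rewrite normrM ler_wpM2r //.
  apply: le_trans (ler_normB _ _) _; rewrite -[leLHS]addr0 lerD // lerD2r.
  exact: wM.
rewrite ler_pM2l // lerBrDl; apply: le_trans (Gn n.+1).
by rewrite {2}/series /= (big_cat_nat (leq0n N) Nn).
Unshelve. all: by end_near. Qed.

(** Quotients of neighbouring normalisations reduce to this one: 'C(n+1+h, h) / 'C(n+h, h) =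
    (n+1+h)/(n+1) and 'C(n+h+1, h+1) / 'C(n+h, h) = (n+1+h)/(h+1). *)
Lemma cvg_shift_ratio (p : nat) : (fun n => n.+1%:R / (n.+1 + p)%:R : R) @ \oo --> (1 : R).
Proof.
have H : (fun n => 1 + p%:R * (n.+1%:R^-1 : R)) @ \oo --> (1 : R).
  rewrite -[X in _ --> X]addr0; apply: cvgD; first exact: cvg_cst.
  by rewrite -[X in _ --> X](mulr0 p%:R); apply: cvgMl_tmp; exact: cvg_harmonic.
rewrite -[X in _ --> X]invr1; apply: (cvg_ext _ (cvgV (oner_neq0 _) H)) => n.
rewrite natrD; have n0 : n.+1%:R != 0 :> R by rewrite pnatr_eq0.
transitivity (1 + p%:R / n.+1%:R : R)^-1 => //.
have -> : 1 + p%:R / n.+1%:R = (n.+1%:R + p%:R) / n.+1%:R :> R by rewrite mulrDl mulfV.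
by rewrite invfM invrK mulrC.
Qed.

(* Orders [h >= 1] are normalised by ['C(n + h - 1, h - 1)], the [h]-fold convolution power of the
   constant sequence 1; order 0 means absolutely summable with sum [c].  With this convention orders
   add up and constants multiply under the two kinds of convolution of [asy_conv0], [asy_conv1]. *)
Definition asy h f c :=
  if h is h'.+1 then (fun n => f n / 'C(n + h', h')%:R) @ \oo --> c
  else asummable f /\ series f @ \oo --> c.

Lemma bin_neq0 n h : 'C(n + h, h)%:R != 0 :> R.
Proof. by rewrite pnatr_eq0 -lt0n bin_gt0 leq_addl. Qed.

Lemma bin_gt0R n h : 0 < 'C(n + h, h)%:R :> R.
Proof. by rewrite ltr0n bin_gt0 leq_addl. Qed.

Lemma asy_ext h f g c : f =1 g -> asy h f c -> asy h g c.
Proof. by move=> /funext ->. Qed.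

Lemma asy_shift h f c : asy h.+1 f c -> asy h.+1 (fun n => f n.-1) c.
Proof.
rewrite /asy => fc; rewrite -[X in _ --> X]mulr1 -cvg_shiftS.
apply: (cvg_ext _ (cvgMn fc (cvg_shift_ratio h))) => n; rewrite ?fctE /=.
have E : (n.+1 + h)%:R * 'C(n + h, h)%:R = n.+1%:R * 'C(n.+1 + h, h)%:R :> R.
  rewrite -!natrM; congr _%:R; have := mul_bin_down (n.+1 + h) h.
  by rewrite addnK addSn.
have nh : (n.+1 + h)%:R != 0 :> R by rewrite pnatr_eq0 addSn.
have n0 : n.+1%:R != 0 :> R by rewrite pnatr_eq0.
have -> : 'C(n.+1 + h, h)%:R = (n.+1 + h)%:R * 'C(n + h, h)%:R / n.+1%:R :> R.
  by rewrite E mulrAC mulfV // mul1r.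
by rewrite !invfM invrK; ring.
Qed.

Lemma asy_shiftn h f c i : asy h.+1 f c -> asy h.+1 (fun n => f (n - i)%N) c.
Proof.
elim: i f => [|i IH] f fc; first by apply: asy_ext fc => n; rewrite subn0.
by apply: asy_ext (IH _ (asy_shift fc)) => n; rewrite subnS.
Qed.

Definition cauchy_prod f g n := \sum_(i < n.+1) f (n - i)%N * g i.

Lemma convC f g n : cauchy_prod f g n = cauchy_prod g f n.
Proof.
rewrite /cauchy_prod (reindex_inj rev_ord_inj) /=; apply: eq_bigr => i _.
have ile : (i <= n)%N by rewrite -ltnS.
by rewrite subSS (subKn ile) mulrC.
Qed.

(** [tannery] with the weights [f (n - i) / 'C(n + h, h)]: they are bounded because the binomial
    increases with [n], and they tend to [c] because a fixed shift does not affect the order. *)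
Lemma asy_conv_summable h f g c e : asummable g -> series g @ \oo --> e ->
  asy h.+1 f c -> asy h.+1 (cauchy_prod g f) (e * c).
Proof.
move=> sg ge fc; have [M [M0 fM]] := cvg_bounded fc; rewrite mulrC.
have := @tannery (fun n i => f (n - i)%N / 'C(n + h, h)%:R) M c e g.
move=> H; apply: (cvg_ext _ (H _ _ sg ge)) => [n|n i i_n|i].
- by rewrite convC mulr_suml; apply: eq_bigr => i _; rewrite mulrAC.
- apply: le_trans (fM (n - i)%N); rewrite !normrM ler_wpM2l // !normfV.
  rewrite !ger0_norm // lef_pV2 ?posrE ?bin_gt0R // ler_nat.
  by apply: leq_bin2l; rewrite leq_add2r leq_subr.
- exact: asy_shiftn fc.
Qed.

Lemma hockey_stick n h : (\sum_(i < n.+1) 'C(i + h, h) = 'C(n + h.+1, h.+1))%N.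
Proof.
elim: n => [|n IH]; first by rewrite big_ord1 !add0n !binn.
by rewrite big_ord_recr /= IH (addSn n h.+1) binS addSnnS.
Qed.

Lemma cvg_div_bin (K : R) h : (fun n => K / 'C(n + h.+1, h.+1)%:R) @ \oo --> (0 : R).
Proof.
rewrite -[X in _ --> X](mulr0 K); apply: cvgMl_tmp.
apply: (squeeze_cvgr _ (cvg_cst (0 : R)) cvg_harmonic).
apply: nearW => n; rewrite invr_ge0 ler0n /= lef_pV2 ?posrE ?bin_gt0R ?ltr0n // ler_nat.
rewrite -hockey_stick; apply: (@leq_trans (\sum_(i < n.+1) 1)).
  by rewrite sum1_card card_ord.
by apply: leq_sum => i _; rewrite bin_gt0 leq_addl.
Qed.

(** A Stolz-Cesaro argument: by [hockey_stick] the new normalisation is the sum of the old ones, so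
    [f i] can be compared with [c * 'C(i + h, h)] term by term. *)
Lemma asy_sum h f c : asy h.+1 f c -> asy h.+2 (fun n => \sum_(i < n.+1) f i) c.
Proof.
move=> fc; apply/cvgrPdist_le => eps eps0.
have e2 : 0 < eps / 2 by rewrite divr_gt0.
move/cvgrPdist_le : (fc) => /(_ _ e2) [N _ NP].
set K := \sum_(i < N) `|c * 'C(i + h, h)%:R - f i|.
have /cvgrPdist_le /(_ _ e2) HK := cvg_div_bin K h.
near=> n; have Nn : (N <= n.+1)%N by near: n; exists N => // m /= /leqW.
have HKn : K / 'C(n + h.+1, h.+1)%:R <= eps / 2.
  by apply: le_trans (ler_norm _) _; rewrite -normrN -sub0r; near: n; exact: HK.
have b0 := bin_gt0R n h.+1.
rewrite -(@ler_pM2r _ 'C(n + h.+1, h.+1)%:R) //.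
rewrite -[X in _ * X <= _](gtr0_norm b0) -normrM mulrBl mulfVK ?gt_eqF //.
rewrite ler_pdivrMr // in HKn.
rewrite -{1}hockey_stick natr_sum mulr_sumr -sumrB.
apply: le_trans (ler_norm_sum _ _ _) _.
rewrite -(big_mkord xpredT (fun i => `|c * 'C(i + h, h)%:R - f i|)) (big_cat_nat (leq0n N) Nn) //=.
rewrite [in leRHS](splitr eps) mulrDl; apply: lerD; first by rewrite big_mkord.
apply: (@le_trans _ _ (\sum_(N <= i < n.+1) eps / 2 * 'C(i + h, h)%:R)).
  apply: ler_sum_nat => i /andP[Ni _]; have bi := bin_gt0R i h.
  rewrite -(@ler_pM2r _ 'C(i + h, h)%:R^-1) ?invr_gt0 // mulfK ?gt_eqF //.
  rewrite -[X in _ * X^-1 <= _](gtr0_norm bi) -normfV -normrM mulrBl mulfK ?gt_eqF //.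
  exact: NP.
rewrite -mulr_sumr ler_pM2l // -hockey_stick natr_sum.
rewrite -(big_mkord xpredT (fun i => 'C(i + h, h)%:R)) (big_cat_nat (leq0n N) Nn) //= lerDr.
exact: sumr_ge0.
Unshelve. all: by end_near. Qed.

Lemma asyD h f g c e : asy h f c -> asy h g e -> asy h (fun n => f n + g n) (c + e).
Proof.
case: h => [|h]; last first.
  by move=> fc ge; apply: (cvg_ext _ (cvgDn fc ge)) => n; rewrite mulrDl.
move=> [sf fc] [sg ge]; split.
  apply: (@asummable_le _ (fun n => `|f n| + `|g n|)) => [n|].
    by rewrite [leRHS]ger0_norm ?addr_ge0 // ler_normD.
  rewrite /asummable (_ : (fun n => _) = (fun n => `|f n|) + (fun n => `|g n|)).
    exact: is_cvg_seriesD.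
  by apply/funext => n; rewrite ger0_norm ?addr_ge0.
have H n : series f n + series g n = series (fun n => f n + g n) n.
  by rewrite /series /= big_split.
exact: cvg_ext H (cvgDn fc ge).
Qed.

Lemma asyZ h f c e : asy h f c -> asy h (fun n => e * f n) (e * c).
Proof.
case: h => [|h]; last first.
  by move=> fc; apply: (cvg_ext _ (cvgMl_tmp (a := e) fc)) => n; rewrite mulrA.
move=> [sf fc]; split.
  rewrite /asummable (_ : (fun n => _) = `|e| *: (fun n => `|f n|)).
    exact: is_cvg_seriesZ.
  by apply/funext => n; rewrite normrM.
have H n : e * series f n = series (fun n => e * f n) n by rewrite /series /= mulr_sumr.
exact: cvg_ext H (cvgMl_tmp (a := e) fc).
Qed.

Lemma asy0 h : asy h (fun=> 0) 0.
Proof.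
case: h => [|h]; last by apply: (cvg_ext _ (cvg_cst _)) => n; rewrite mul0r.
split; last by apply: (cvg_ext _ (cvg_cst _)) => n; rewrite /series /= big1.
by apply: (@bounded_asummable _ 0) => n; rewrite /series /= big1 // => i _; rewrite normr0.
Qed.

Lemma asy_big (I : Type) (r : seq I) (P : pred I) h (f : I -> nat -> R) (c : I -> R) :
  (forall i, P i -> asy h (f i) (c i)) ->
  asy h (fun n => \sum_(i <- r | P i) f i n) (\sum_(i <- r | P i) c i).
Proof.
move=> fc; elim: r => [|i r IH].
  by rewrite big_nil; apply: asy_ext (asy0 h) => n; rewrite big_nil.
rewrite big_cons; case: ifPn => Pi; last first.
  by apply: asy_ext IH => n; rewrite big_cons (negbTE Pi).
by apply: asy_ext (asyD (fc _ Pi) IH) => n; rewrite big_cons Pi.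
Qed.

(** The terms of a convergent series tend to 0, and for positive orders the quotient of the two
    normalisations is (h+1)/(n+1+h). Through this, paths that are not maximal drop out. *)
Lemma asyS h f c : asy h f c -> asy h.+1 f 0.
Proof.
case: h => [[sf fc]|h fc] /=.
  have : cvgn (series f) by apply/cvg_ex; exists c.
  by move=> /cvg_series_cvg_0; apply: cvg_ext => n; rewrite bin0 divr1.
have Hr : (fun n => h.+1%:R * (n.+1%:R / (n.+1 + h)%:R) * n.+1%:R^-1 : R) @ \oo --> (0 : R).
  rewrite -[X in _ --> X](mulr0 (h.+1%:R * 1)); apply: cvgM; last exact: cvg_harmonic.
  by apply: cvgMl_tmp; exact: cvg_shift_ratio.
rewrite -[X in _ --> X](mulr0 c); apply: (cvg_ext _ (cvgMn fc Hr)) => n.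
rewrite -!mulrA; congr (_ * _).
have E : (n + h.+1)%:R * 'C(n + h, h)%:R = h.+1%:R * 'C(n + h.+1, h.+1)%:R :> R.
  by rewrite -!natrM addnS -mul_bin_diag.
have n0 : n.+1%:R != 0 :> R by rewrite pnatr_eq0.
have nh : (n + h.+1)%:R != 0 :> R by rewrite pnatr_eq0 addnS.
have -> : 'C(n + h.+1, h.+1)%:R = (n + h.+1)%:R * 'C(n + h, h)%:R / h.+1%:R :> R.
  by rewrite E mulrAC mulfV ?mul1r // pnatr_eq0.
rewrite !invfM invrK addSnnS.
transitivity ('C(n + h, h)%:R^-1 * h.+1%:R * (n + h.+1)%:R^-1 * (n.+1%:R / n.+1%:R) : R).
  by ring.
by rewrite mulfV // mulr1; ring.
Qed.

Lemma asy_lt h h' f c : asy h f c -> (h < h')%N -> asy h' f 0.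
Proof.
move=> fc; elim: h' => // h' IH; rewrite ltnS leq_eqVlt => /orP[/eqP <-|]; first exact: asyS fc.
by move=> /IH /asyS.
Qed.

(** For [h = 0] the partial sums of the product are the convolution of [g] with the partial sums of
    [f]; these have order 1 and constant [c], which reduces the claim to the case of positive
    order. *)
Lemma asy_conv0 h f g c e : asummable g -> series g @ \oo --> e ->
  asy h f c -> asy h (cauchy_prod g f) (e * c).
Proof.
case: h => [|h] sg ge; last exact: asy_conv_summable.
have partial (a b : nat -> R) n : series (cauchy_prod a b) n.+1 = cauchy_prod a (fun m => series b m.+1) n.
  rewrite /series /= big_mkord; elim: n => [|n IH].
    by rewrite /cauchy_prod !big_ord1 /= big_nat1.
  rewrite big_ord_recr /= IH /cauchy_prod [in RHS]big_ord_recl /= subn0.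
  rewrite [in X in _ + X = _]big_ord_recl /= subn0 addrCA; congr (_ + _).
    by rewrite big_nat1.
  by rewrite -big_split; apply: eq_bigr => i _; rewrite /= /bump add1n subSS -mulrDr
    [in RHS]big_nat_recr.
have order1 a c' : series a @ \oo --> c' -> asy 1 (fun m => series a m.+1) c'.
  move=> ac; rewrite /asy; apply: (@cvg_ext (fun m => series a m.+1)).
    by move=> n; rewrite bin0 divr1.
  by rewrite (cvg_shiftS (series a)).
have main a b c' e' : asummable a -> series a @ \oo --> e' -> series b @ \oo --> c' ->
    series (cauchy_prod a b) @ \oo --> e' * c'.
  move=> sa ae bc; rewrite -cvg_shiftS.
  apply: (cvg_ext _ (asy_conv_summable sa ae (order1 _ _ bc))) => n.
  by rewrite bin0 divr1 /= partial.
(* Absolute summability: the same argument for the sequences of absolute values, whose product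
   dominates. *)
move=> [sf fc]; split; last exact: main.
pose nf n := `|f n|; pose ng n := `|g n|.
apply: (@asummable_le _ (cauchy_prod ng nf)) => [n|].
  apply: le_trans (ler_norm_sum _ _ _) _; apply: le_trans (ler_norm _).
  by apply: ler_sum => i _; rewrite normrM.
have sng : asummable ng by apply: asummable_le sg => n; rewrite normr_id.
rewrite /asummable; have -> : (fun n => `|cauchy_prod ng nf n|) = cauchy_prod ng nf.
  by apply/funext => n; rewrite ger0_norm // sumr_ge0 // => i _; apply: mulr_ge0; exact: normr_ge0.
by apply/cvg_ex; eexists; apply: main sng sg sf.
Qed.

(** Split [g] into [g - e] and the constant [e]: the first part keeps order [h], hence has constant
    0 in order [h + 1], and the second turns the convolution into partial summation. *)
Lemma asy_conv1 h f g c e : asummable (fun n => g n - e) ->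
  asy h f c -> asy h.+1 (cauchy_prod g f) (e * c).
Proof.
move=> sg fc; have sg' : cvgn (series (fun n => g n - e)) by exact: normed_cvg.
have /asyS H := asy_conv0 sg sg' fc.
have fS : asy h.+1 (fun n => \sum_(i < n.+1) f i) c.
  case: h fc {H} => [[_ fc]|h]; last exact: asy_sum.
  rewrite /asy; apply: (@cvg_ext (fun m => series f m.+1)).
    by move=> n; rewrite bin0 divr1 /series /= big_mkord.
  by rewrite (cvg_shiftS (series f)).
rewrite -[e * c]add0r; apply: asy_ext (asyD H (asyZ e fS)) => n.
rewrite /cauchy_prod mulr_sumr -big_split; apply: eq_bigr => i _ /=; ring.
Qed.

(** The delay caused by one transition between blocks. Since a 0 is inserted and no term is
    repeated, sums are preserved and order 0 is covered as well. *)
Lemma asy_pred h f c : asy h f c -> asy h (fun n => if n is m.+1 then f m else 0) c.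
Proof.
case: h => [|h].
  move=> [sf fc]; split.
    rewrite /asummable; move: sf => /cvg_ex [l fl]; apply/cvg_ex; exists l.
    rewrite -cvg_shiftS; apply: (@cvg_ext (series (fun n => `|f n|))) => // n.
    by rewrite /series /= big_nat_recl //= normr0 add0r.
  rewrite -cvg_shiftS; apply: (@cvg_ext (series f)) => // n.
  by rewrite /series /= big_nat_recl //= add0r.
move=> /asy_shift; rewrite /asy -cvg_shiftS => H; rewrite -cvg_shiftS.
exact: H.
Qed.

Lemma asy_ratio h f g c e : asy h.+2 f c -> asy h.+1 g e -> e != 0 ->
  (fun n => f n / n.+1%:R / g n) @ \oo --> h.+1%:R^-1 * (c / e).
Proof.
move=> fc ge e0.
have H : (fun n => (n.+1%:R / (n.+1 + h)%:R)^-1 : R) @ \oo --> (1 : R).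
  by rewrite -[X in _ --> X]invr1; apply: cvgV (oner_neq0 _) (cvg_shift_ratio h).
have -> : h.+1%:R^-1 * (c / e) = c * e^-1 * (1 * h.+1%:R^-1) by rewrite mul1r mulrC.
have HH : (fun n => (f n / 'C(n + h.+1, h.+1)%:R) * (g n / 'C(n + h, h)%:R)^-1 *
    ((n.+1%:R / (n.+1 + h)%:R)^-1 * h.+1%:R^-1)) @ \oo --> c * e^-1 * (1 * h.+1%:R^-1).
  apply: cvgMn; last by apply: cvgMn => //; exact: cvg_cst.
  by apply: cvgMn => //; exact: cvgV e0 ge.
apply: (cvg_ext _ HH) => n.
have E : (n.+1 + h)%:R * 'C(n + h, h)%:R = h.+1%:R * 'C(n + h.+1, h.+1)%:R :> R.
  by rewrite -!natrM addnS -mul_bin_diag addSn.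
have n0 : n.+1%:R != 0 :> R by rewrite pnatr_eq0.
have h0 : h.+1%:R != 0 :> R by rewrite pnatr_eq0.
have b1 := bin_neq0 n h.+1.
have -> : 'C(n + h.+1, h.+1)%:R = (n.+1 + h)%:R * 'C(n + h, h)%:R / h.+1%:R :> R.
  by rewrite E mulrAC mulfV // mul1r.
rewrite !invfM !invrK.
have nh : (n.+1 + h)%:R != 0 :> R by rewrite pnatr_eq0 addSn.
have b0 := bin_neq0 n h.
transitivity (f n * (g n)^-1 * n.+1%:R^-1 * ((n.+1 + h)%:R / (n.+1 + h)%:R) *
  ('C(n + h, h)%:R / 'C(n + h, h)%:R) * (h.+1%:R / h.+1%:R)); first by ring.
by rewrite !divff // !mulr1 mulrAC.
Qed.

End Sequences.

(** * Perron-Frobenius theory of eventually positive matrices *)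

Section Perron.
Context {R : realType} {n : nat}.
Implicit Types (A : 'M[R]_n) (rho : R) (v : 'cV[R]_n) (u y : 'rV[R]_n).

(** A partial sum S satisfies S <= m1 a_0 + gam S: the first [m1] terms are at most a_0 by
    monotonicity, and the later ones are contracted. *)
Lemma asummable_contraction (a : nat -> R) (m1 : nat) (gam : R) :
  gam < 1 -> (forall m, 0 <= a m) -> (forall m, a m.+1 <= a m) ->
  (forall m, a (m1 + m)%N <= gam * a m) -> asummable a.
Proof.
move=> g1 a0 aS ag; apply: (@bounded_asummable _ _ (a 0%N *+ m1 / (1 - gam))) => N.
rewrite ler_pdivlMr ?subr_gt0 // mulrBr mulr1 lerBlDr.
have -> : series (fun n => `|a n|) N = \sum_(0 <= i < N) a i.
  by apply: eq_bigr => i _; rewrite ger0_norm.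
have a0m m : a m <= a 0%N by elim: m => // m IH; exact: le_trans (aS m) IH.
apply: (@le_trans _ _ (\sum_(0 <= i < m1 + N) a i)).
  by rewrite (big_cat_nat (leq0n N) (leq_addl m1 N)) /= lerDl sumr_ge0.
rewrite (big_cat_nat (leq0n m1) (leq_addr N m1)) /=; apply: lerD.
  by rewrite -[X in _ *+ X]subn0 -sumr_const_nat; apply: ler_sum_nat.
rewrite -{1}[m1]add0n big_addn addnC addnK mulrC mulr_sumr.
by apply: ler_sum_nat => i _; rewrite addnC.
Qed.

Lemma finite_lower_bound (I : finType) (f : I -> R) :
  (forall i, 0 < f i) -> exists2 eps, 0 < eps & forall i, eps <= f i.
Proof.
move=> f0; exists (\big[Num.min/1]_i f i).
  by elim/big_ind: _ => // x y x0 y0; rewrite lt_min x0.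
by move=> i; apply: bigmin_le_cond.
Qed.

Definition perron A rho v :=
  [/\ forall a b, 0 <= A a b,
      exists m0, forall m, (m0 <= m)%N -> forall a b, 0 < (A ^+ m) a b,
      forall a, 0 < v a 0, A *m v = rho *: v & \sum_a v a 0 = 1].

Lemma eigen_exp A rho v m : A *m v = rho *: v -> A ^+ m *m v = rho ^+ m *: v.
Proof.
move=> Av; elim: m => [|m IH]; first by rewrite !expr0 mul1mx scale1r.
by rewrite !exprSr -mulmxE -mulmxA Av -scalemxAr IH scalerA mulrC.
Qed.

Lemma left_eigen_exp A rho u m : u *m A = rho *: u -> u *m A ^+ m = rho ^+ m *: u.
Proof.
move=> uA; elim: m => [|m IH]; first by rewrite !expr0 mulmx1 scale1r.
by rewrite !exprS -mulmxE mulmxA uA -scalemxAl IH scalerA.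
Qed.

(** An empty sum is 0, so the normalisation of [v] excludes dimension 0. *)
Lemma perron_index A rho v : perron A rho v -> exists a : 'I_n, True.
Proof.
case=> _ _ _ _ v1; case: (pickP (fun _ : 'I_n => true)) => [a _|E]; first by exists a.
by move: v1; rewrite big_pred0 // => /esym/eqP; rewrite oner_eq0.
Qed.

Lemma perron_root_gt0 A rho v : perron A rho v -> 0 < rho.
Proof.
move=> pA; have [a _] := perron_index pA; case: pA => _ [m0 Am] v0 Av _.
have pos m : (m0 <= m)%N -> 0 < rho ^+ m.
  move=> m0m; rewrite -(pmulr_lgt0 _ (v0 a)).
  have := congr1 (fun x : 'cV_n => x a 0) (eigen_exp m Av).
  rewrite !mxE => <-; rewrite (bigD1 a) //= ltr_pwDl ?mulr_gt0 ?Am // sumr_ge0 // => b _.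
  by rewrite mulr_ge0 // ltW ?Am.
(* Two consecutive positive powers determine the sign of [rho]. *)
by move: (pos m0.+1 (leqnSn _)); rewrite exprS pmulr_lgt0 // pos.
Qed.

(** The l1 norm on rows weighted by [v]. With these weights a nonnegative matrix [C] with
    [C v = mu v] has operator norm at most [mu] ([vnorm_mul]). *)
Definition vnorm v y : R := \sum_a `|y 0 a| * v a 0.

Lemma vnorm_ge0 v y : (forall a, 0 < v a 0) -> 0 <= vnorm v y.
Proof. by move=> v0; apply: sumr_ge0 => a _; rewrite mulr_ge0 // ltW. Qed.

Lemma vnorm_entry v y b : (forall a, 0 < v a 0) -> `|y 0 b| <= vnorm v y / v b 0.
Proof.
move=> v0; rewrite ler_pdivlMr // /vnorm (bigD1 b) //= lerDl sumr_ge0 // => a _.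
by rewrite mulr_ge0 // ltW.
Qed.

Lemma vnormZ v y c : vnorm v (c *: y) = `|c| * vnorm v y.
Proof. by rewrite mulr_sumr; apply: eq_bigr => a _; rewrite mxE normrM mulrA. Qed.

Lemma vnorm_mul (C : 'M[R]_n) v y mu : (forall a b, 0 <= C a b) -> (forall a, 0 < v a 0) ->
  C *m v = mu *: v -> vnorm v (y *m C) <= mu * vnorm v y.
Proof.
move=> C0 v0 Cv.
apply: (@le_trans _ _ (\sum_b \sum_a `|y 0 a| * C a b * v b 0)).
  apply: ler_sum => b _; rewrite -mulr_suml; apply: ler_wpM2r; first exact: ltW.
  rewrite mxE; apply: le_trans (ler_norm_sum _ _ _) _; apply: ler_sum => a _.
  by rewrite normrM (ger0_norm (C0 a b)).
rewrite exchange_big /= mulr_sumr; apply: ler_sum => a _.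
have := congr1 (fun x : 'cV_n => x a 0) Cv; rewrite !mxE => Cva.
by rewrite mulrCA -Cva mulr_sumr; apply: ler_sum => b _; rewrite mulrA.
Qed.

(* Doeblin's argument: for some [m], [A ^+ m] dominates [delta rho^m v 1^T], which annihilates
   every row [y] orthogonal to [v]; the remainder is nonnegative and maps [v] to
   [(1 - delta) rho^m v]. *)
Lemma perron_contraction A rho v : perron A rho v ->
  exists m gam, gam < 1 /\ forall y, (y *m v) 0 0 = 0 ->
    vnorm v (y *m A ^+ m) <= gam * rho ^+ m * vnorm v y.
Proof.
move=> pA; have r0 := perron_root_gt0 pA; case: pA => A0 [m Am] v0 Av v1.
have rm0 : 0 < rho ^+ m by rewrite exprn_gt0.
have [eps e0 eP] := @finite_lower_bound _ (fun ab : 'I_n * 'I_n =>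
  (A ^+ m) ab.1 ab.2 / (v ab.1 0 * rho ^+ m)) (fun ab =>
  divr_gt0 (Am m (leqnn m) _ _) (mulr_gt0 (v0 _) rm0)).
exists m, (1 - eps); split=> [|y yv]; first by rewrite ltrBlDr ltrDl.
pose C := A ^+ m - (eps * rho ^+ m) *: (v *m const_mx 1).
have -> : y *m A ^+ m = y *m C.
  have yv0 : y *m v = 0 by rewrite [LHS]mx11_scalar yv raddf0.
  by rewrite mulmxBr -scalemxAr mulmxA yv0 mul0mx scaler0 subr0.
apply: vnorm_mul => // [a b|].
  rewrite !mxE big_ord1 mxE mulr1 subr_ge0.
  by have := eP (a, b); rewrite ler_pdivlMr ?mulr_gt0 //= (mulrC (v a 0)) mulrA.
rewrite mulmxBl (eigen_exp _ Av) -scalemxAl -mulmxA.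
have -> : (const_mx 1 : 'rV[R]_n) *m v = 1%:M.
  apply/matrixP => i j; rewrite !ord1 !mxE -[RHS]v1.
  by apply: eq_bigr => a _; rewrite mxE mul1r.
by rewrite mulmx1 -scalerBl mulrBl mul1r.
Qed.

(** [A ^+ m] multiplies the norm of such a row by exactly rho^m, but by [perron_contraction] by at
    most gam rho^m with gam < 1. This carries the simplicity of [rho]. *)
Lemma perron_fixed_row A rho v y : perron A rho v ->
  y *m A = rho *: y -> (y *m v) 0 0 = 0 -> y = 0.
Proof.
move=> pA yA yv; have r0 := perron_root_gt0 pA.
have [m [gam [g1 /(_ y yv)]]] := perron_contraction pA.
case: pA => _ _ v0 _ _.
rewrite (left_eigen_exp _ yA) vnormZ (ger0_norm (exprn_ge0 m (ltW r0))) mulrAC.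
rewrite [leRHS]mulrC (ler_pM2l (exprn_gt0 m r0)) => le_y.
have y0 : vnorm v y = 0.
  apply: le_anti; rewrite (vnorm_ge0 _ v0) andbT.
  have g0 : 0 < 1 - gam by rewrite subr_gt0.
  by rewrite -(pmulr_rle0 _ g0) mulrBl mul1r subr_le0.
apply/rowP => b; rewrite mxE; apply/eqP; rewrite -normr_le0.
by apply: le_trans (vnorm_entry _ _ v0) _; rewrite y0 mul0r.
Qed.

Definition left_perron A rho v u := u *m A = rho *: u /\ (u *m v) 0 0 = 1.

(** [v] makes [A - rho] singular, so a left null vector [w] exists; [w v] is nonzero by
    [perron_fixed_row], which permits the normalisation. *)
Lemma left_perron_exists A rho v : perron A rho v -> exists u, left_perron A rho v u.
Proof.
move=> pA; have [a _] := perron_index pA.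
have [_ _ v0 Av _] := pA.
have /det0P [w w0 wA] : \det (A - rho%:M) == 0.
  rewrite -det_tr; apply/det0P; exists v^T.
    by apply/eqP => /rowP /(_ a); rewrite !mxE => va; have := v0 a; rewrite va ltxx.
  by rewrite -trmx_mul mulmxBl mul_scalar_mx Av subrr trmx0.
have wr : w *m A = rho *: w.
  by apply/eqP; rewrite -subr_eq0 -mul_mx_scalar -mulmxBr wA.
have wv : (w *m v) 0 0 != 0.
  by apply: contra_neq w0 => wv0; apply: perron_fixed_row pA wr wv0.
exists (((w *m v) 0 0)^-1 *: w); split.
  by rewrite -scalemxAl wr !scalerA mulrC.
by rewrite -scalemxAl mxE mulVf.
Qed.

Lemma left_perron_uniq A rho v u u' : perron A rho v ->
  left_perron A rho v u -> left_perron A rho v u' -> u = u'.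
Proof.
move=> pA [uA uv] [u'A u'v]; apply/eqP; rewrite -subr_eq0; apply/eqP.
apply: perron_fixed_row pA _ _.
  by rewrite mulmxBl uA u'A scalerBr.
by rewrite mulmxBl mxE uv mxE u'v subrr.
Qed.

(** The row e_a - v_a u is orthogonal to [v] and remains so under [A]; its image under [A ^+ m] is
    the error in row [a] times rho^m, and its scaled norm decays by [perron_contraction]. *)
Lemma perron_summable A rho v u a b : perron A rho v -> left_perron A rho v u ->
  asummable (fun m => (A ^+ m) a b / rho ^+ m - v a 0 * u 0 b).
Proof.
move=> pA [uA uv]; have r0 := perron_root_gt0 pA.
have [m1 [gam [g1 contr]]] := perron_contraction pA; case: pA => A0 _ v0 Av _.
pose y : 'rV[R]_n := row a 1%:M - v a 0 *: u.
have yv : y *m v = 0.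
  apply/matrixP => i j; rewrite !ord1 mulmxBl -row_mul mul1mx -scalemxAl !mxE.
  by move: uv; rewrite mxE => ->; rewrite mulr1 subrr.
have yAv m : (y *m A ^+ m *m v) 0 0 = 0.
  by rewrite -mulmxA (eigen_exp _ Av) -scalemxAr yv scaler0 mxE.
have rm m : 0 < rho ^+ m by rewrite exprn_gt0.
pose s m := vnorm v (y *m A ^+ m) / rho ^+ m.
have ss : asummable s.
  apply: (@asummable_contraction _ m1 gam) => // m.
  - by rewrite divr_ge0 ?vnorm_ge0 // ltW.
  - rewrite /s ler_pdivrMr // (exprSr rho) mulrA divfK ?gt_eqF // mulrC.
    by rewrite exprSr -mulmxE mulmxA; apply: vnorm_mul.
  - rewrite /s ler_pdivrMr // !exprD -mulmxE.
    have -> : A ^+ m1 *m A ^+ m = A ^+ m *m A ^+ m1 by rewrite !mulmxE -!exprD addnC.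
    rewrite mulmxA; apply: le_trans (contr _ (yAv m)) _.
    by rewrite le_eqVlt; apply/orP; left; apply/eqP; field; rewrite gt_eqF.
apply: (@asummable_le _ _ (fun m => (v b 0)^-1 * s m)) => [m|]; last first.
  have := is_cvg_seriesZ (k := `|(v b 0)^-1|) ss; rewrite /asummable.
  by congr (cvgn (series _)); apply/funext => m; rewrite normrM.
have -> : (A ^+ m) a b / rho ^+ m - v a 0 * u 0 b = (y *m A ^+ m) 0 b / rho ^+ m.
  rewrite mulmxBl -row_mul mul1mx -scalemxAl (left_eigen_exp _ uA) !mxE.
  by rewrite mulrBl; congr (_ - _); rewrite mulrA mulrAC mulfK ?gt_eqF.
rewrite normrM normfV (gtr0_norm (rm m)) (@ger0_norm _ (_ * s m)); last first.
  by rewrite mulr_ge0 ?divr_ge0 ?vnorm_ge0 ?invr_ge0 // ltW.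
rewrite mulrA ler_pM2r ?invr_gt0 // mulrC; exact: vnorm_entry.
Qed.

(** v_a u_b is the limit of the nonnegative numbers (A^m)_ab / rho^m. *)
Lemma left_perron_ge0 A rho v u b : perron A rho v -> left_perron A rho v u -> 0 <= u 0 b.
Proof.
move=> pA lu; have r0 := perron_root_gt0 pA; have [a _] := perron_index pA.
have s0 := perron_summable (a:=a) (b:=b) pA lu.
have [A0 _ v0 _ _] := pA.
have l0 := cvg_series_cvg_0 (normed_cvg s0).
have Am m : 0 <= (A ^+ m) a b.
  elim: m a b {s0 l0} => [|m IH] a b; first by rewrite expr0 mxE; case: eqP.
  by rewrite exprS -mulmxE mxE sumr_ge0 // => c _; rewrite mulr_ge0.
rewrite -(pmulr_rge0 _ (v0 a)).
have H : (fun m => (A ^+ m) a b / rho ^+ m - v a 0 * u 0 b + v a 0 * u 0 b) @ \oo --> v a 0 * u 0 b.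
  by rewrite -[X in _ --> X]add0r; apply: cvgDn l0 _; exact: cvg_cst.
apply: (cvgr_to_ge H); apply: nearW => m.
by rewrite subrK divr_ge0 // exprn_ge0 // ltW.
Qed.

(** This matrix sends [v] to [-v], so a left null row is orthogonal to [v] and then fixed up to
    [rho], hence 0. Invertibility survives complexification, and so carries the simplicity of [rho]
    over to complex vectors. *)
Lemma perron_shift_unit A rho v u : perron A rho v -> left_perron A rho v u ->
  A - rho%:M - v *m u \in unitmx.
Proof.
move=> pA [uA uv]; have [_ _ v0 Av _] := pA.
rewrite unitmxE unitfE; apply/det0P => -[y y0 yN].
have uv1 : u *m v = 1%:M by rewrite [LHS]mx11_scalar uv.
have Nv : (A - rho%:M - v *m u) *m v = - v.
  by rewrite !mulmxBl Av mul_scalar_mx subrr -mulmxA uv1 mulmx1 sub0r.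
have yv0 : y *m v = 0 by apply: oppr_inj; rewrite -mulmxN -Nv mulmxA yN mul0mx oppr0.
have yv : (y *m v) 0 0 = 0 by rewrite yv0 mxE.
case/eqP: y0; apply: perron_fixed_row pA _ yv.
move/eqP: yN; rewrite !mulmxBr mulmxA yv0 mul0mx subr0 mul_mx_scalar.
by rewrite subr_eq0 => /eqP.
Qed.

End Perron.

(** * The complement V^- as the kernel of the left Perron eigenvector *)

Section GeneralisedEigenspaces.
Context {R : realType}.
Local Notation C := R[i].

Lemma cplx_mxM m n p (A : 'M[R]_(m, n)) (B : 'M[R]_(n, p)) :
  cplx_mx (A *m B) = cplx_mx A *m cplx_mx B.
Proof. by rewrite /cplx_mx (map_mxM (real_complex R)). Qed.

Lemma cplx_mxZ m n (a : R) (A : 'M[R]_(m, n)) : cplx_mx (a *: A) = (a%:C)%C *: cplx_mx A.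
Proof. by rewrite /cplx_mx (map_mxZ (real_complex R)). Qed.

(** Giving every distinct root the exponent [n] yields a multiple of the characteristic polynomial,
    which annihilates [M] by Cayley-Hamilton; its factors are pairwise coprime, so their kernels
    span. *)
Lemma generalised_decomposition n (M : 'M[C]_n) (w : 'rV[C]_n) :
  exists (m : nat) (lam : 'I_m -> C) (ws : 'I_m -> 'rV[C]_n),
    [/\ injective lam, forall j, ws j *m (M - (lam j)%:M) ^+ n = 0 & w = \sum_(j < m) ws j].
Proof.
case: n => [|n] in M w *.
  exists 0%N, (fun=> 0), (fun=> 0); split=> [[]//|[]//|].
  by rewrite big_ord0; apply/rowP => -[].
have [r rP] := closed_field_poly_normal (char_poly M).
rewrite (monicP (char_poly_monic M)) scale1r in rP.
pose s := undup r; pose lam (j : 'I_(size s)) := tnth (in_tuple s) j.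
have lam_inj : injective lam.
  by move=> i j /eqP; rewrite /lam !(tnth_nth 0) /= nth_uniq ?undup_uniq // => /eqP /val_inj.
pose p := \prod_(j < size s) ('X - (lam j)%:P) ^+ n.+1.
have root_dvd z : z \in r -> ('X - z%:P) %| \prod_(j < size s) ('X - (lam j)%:P).
  move=> zr; have /tnthP [j ->] : z \in in_tuple s by rewrite mem_undup.
  rewrite (bigD1 j) //=; exact: dvdp_mulr.
have char_dvd : char_poly M %| p.
  have sr : size r = n.+1.
    by apply: succn_inj; rewrite -(size_char_poly M) rP size_prod_XsubC.
  rewrite rP /p prodrXl -sr; elim: (r) root_dvd => [|z t IH] H.
    by rewrite big_nil dvd1p.
  rewrite big_cons /= exprS dvdp_mul //; first by rewrite H ?mem_head.
  by apply: IH => y yt; rewrite H // inE yt orbT.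
have pM : horner_mx M p = 0.
  have /dvdpP [q ->] := char_dvd.
  by rewrite rmorphM /= Cayley_Hamilton mulr0.
have : (w <= \sum_(j < size s) kermxpoly M (('X - (lam j)%:P) ^+ n.+1))%MS.
  rewrite -(kermxpoly_prod M) /kermxpoly ?pM ?kermx0 ?submx1 //.
  move=> i j _ _ ij; rewrite coprimep_expl // coprimep_expr // coprimep_XsubC2 //.
  by rewrite subr_eq0; apply: contra_neq ij => /lam_inj.
case/sub_sumsmxP => ws wE.
exists (size s), lam, (fun j => ws j *m kermxpoly M (('X - (lam j)%:P) ^+ n.+1)); split=> // j.
apply/sub_kermxP; rewrite -geigenspaceE; exact: submxMl.
Qed.

Lemma trmx_exp n (A : 'M[C]_n) m : (A ^+ m)^T = A^T ^+ m.
Proof.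
elim: m => [|m IH]; first by rewrite !expr0 trmx1.
by rewrite exprS exprSr -!mulmxE trmx_mul IH.
Qed.

Lemma left_eigen_gen n (M : 'M[C]_n) (a lam : C) (U : 'rV[C]_n) m :
  U *m M = a *: U -> U *m (M - lam%:M) ^+ m = (a - lam) ^+ m *: U.
Proof.
move=> UM; elim: m => [|m IH]; first by rewrite !expr0 mulmx1 scale1r.
rewrite exprS -mulmxE mulmxA mulmxBr UM mul_mx_scalar -scalerBl -scalemxAl IH.
by rewrite scalerA exprS.
Qed.

(* [u] annihilates the generalised eigenspaces for [lam != rho].  Conversely, the component of [w] in
   the generalised eigenspace for [rho] is killed by [u], hence zero since [A - rho - v u] is
   invertible. *)
Lemma VminusP n (A : 'M[R]_n) rho v u w : perron A rho v -> left_perron A rho v u ->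
  Vminus A rho w <-> (u *m w) 0 0 = 0.
Proof.
move=> pA lu; have N1 := perron_shift_unit pA lu; have [uA uv] := lu.
have [a0 _] := perron_index pA.
have UM : cplx_mx u *m cplx_mx A = (rho%:C)%C *: cplx_mx u by rewrite -cplx_mxM uA cplx_mxZ.
have kill lam (x : 'cV[C]_n) : lam != (rho%:C)%C -> (cplx_mx A - lam%:M) ^+ n *m x = 0 ->
    cplx_mx u *m x = 0.
  move=> lr xA; have := left_eigen_gen lam n UM => /(congr1 (mulmx^~ x)).
  rewrite /= -mulmxA xA mulmx0 -scalemxAl => /esym/eqP.
  by rewrite scaler_eq0 expf_eq0 subr_eq0 eq_sym (negbTE lr) andbF => /eqP.
split=> [[m [lam [ws [wsP wE]]]]|uw].
  have : cplx_mx (u *m w) = 0.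
    rewrite cplx_mxM wE mulmx_sumr big1 // => j _.
    by have [lr] := wsP j; exact: kill.
  by move=> /matrixP /(_ 0 0); rewrite !mxE => -[].
have Uw : cplx_mx u *m cplx_mx w = 0.
  by rewrite -cplx_mxM [u *m w]mx11_scalar uw raddf0 /cplx_mx (map_mx0 (real_complex R)).
(* Kernels act on rows in [generalised_decomposition], hence the transposes. *)
have [m [lam [ws [lam_inj wsP wE]]]] := generalised_decomposition (cplx_mx A)^T (cplx_mx w)^T.
have xP j : (cplx_mx A - (lam j)%:M) ^+ n *m (ws j)^T = 0.
  by rewrite -[LHS]trmxK trmx_mul trmx_exp trmxK linearB /= tr_scalar_mx wsP trmx0.
have {}wE : cplx_mx w = \sum_(j < m) (ws j)^T by rewrite -[LHS]trmxK wE linear_sum.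
have NC : cplx_mx A - ((rho%:C)%C)%:M - cplx_mx v *m cplx_mx u \in unitmx.
  rewrite -cplx_mxM /cplx_mx -(map_scalar_mx (real_complex R)) -!(map_mxB (real_complex R)).
  by rewrite map_unitmx.
(* Induction on the exponent: [u] also kills (A - rho) x, so (A - rho) x = 0, and then A - rho - v u
   kills x. *)
have ker0 k (x : 'cV[C]_n) : (cplx_mx A - ((rho%:C)%C)%:M) ^+ k *m x = 0 -> cplx_mx u *m x = 0 -> x = 0.
  elim: k x => [|k IH] x; first by rewrite expr0 mul1mx.
  rewrite exprSr -mulmxE -mulmxA => Mx Ux.
  have Ax : (cplx_mx A - ((rho%:C)%C)%:M) *m x = 0.
    by apply: IH Mx _; rewrite mulmxA mulmxBr UM mul_mx_scalar subrr mul0mx.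
  have : (cplx_mx A - ((rho%:C)%C)%:M - cplx_mx v *m cplx_mx u) *m x = 0.
    by rewrite mulmxBl Ax -mulmxA Ux mulmx0 subrr.
  by move=> /(congr1 (mulmx (invmx (cplx_mx A - ((rho%:C)%C)%:M - cplx_mx v *m cplx_mx u))));
    rewrite mulmxA mulVmx // mul1mx mulmx0.
have x0 j : lam j = (rho%:C)%C -> (ws j)^T = 0.
  move=> lj; apply: (ker0 n); first by rewrite -lj.
  move: Uw; rewrite wE mulmx_sumr (bigD1 j) //= big1 ?addr0 // => i ij.
  by apply: kill (xP i); rewrite -lj; apply: contra_neq ij => /lam_inj.
(* The component for [rho] is 0, so it may be listed under any value other than [rho]; [rho + 1] is
   taken. *)
exists m, (fun j => if lam j == (rho%:C)%C then (rho%:C)%C + 1 else lam j), (fun j => (ws j)^T).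
split=> // j; case: ifPn => [/eqP lj|lj]; last by [].
by rewrite x0 // mulmx0 -subr_eq0 addrAC subrr add0r oner_neq0.
Qed.

Lemma Vminus_coef n (A : 'M[R]_n) rho v u x : perron A rho v -> left_perron A rho v u ->
  xget 0 [set a : R | Vminus A rho (x - a *: v)] = (u *m x) 0 0.
Proof.
move=> pA lu; have [_ uv] := lu.
have E (a : R) : (u *m (x - a *: v)) 0 0 = (u *m x) 0 0 - a.
  by rewrite mulmxBr -scalemxAr mxE [X in _ + X]mxE [X in _ - X]mxE uv mulr1.
apply: xget_unique => /= [|a].
  by apply/(VminusP _ pA lu); rewrite E subrr.
by move/(VminusP _ pA lu); rewrite E => /eqP; rewrite subr_eq0 => /eqP.
Qed.

End GeneralisedEigenspaces.

(** * Expansion of linear recursions along paths of blocks *)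

Section PathExpansion.
Context {R : realType} {d k : nat}.
Implicit Types (x y : 'I_k) (p q s t : seq 'I_k).

(** Subsequences built by cons, so that sums over decreasing paths split at the leading block. *)
Fixpoint subs s : seq (seq 'I_k) :=
  if s is x :: t then [seq x :: q | q <- subs t] ++ subs t else [:: [::]].

Lemma mem_subs p s : (p \in subs s) = subseq p s.
Proof.
elim: s p => [|x t IH] p; first by rewrite inE; case: p.
rewrite mem_cat IH; case: p => [|y q]; first by rewrite orbC !sub0seq.
rewrite /=; case: eqP => [->|yx].
  apply/orP/idP => [[/mapP[r rt [->]]|H]|qt]; first by rewrite -IH.
    exact: subseq_trans (subseq_cons _ _) H.
  by left; apply: map_f; rewrite IH.
by apply/orP/idP => [[/mapP[r _ [/yx]]|]|] //; right.
Qed.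

Lemma subs_uniq s : uniq s -> uniq (subs s).
Proof.
elim: s => [//|x t IH] /= /andP[xt tu]; rewrite cat_uniq IH // andbT map_inj_uniq ?IH //=.
  apply/hasPn => q; rewrite mem_subs => qt; apply/mapP => -[r _ E].
  by move: xt; rewrite (mem_subseq qt) // E mem_head.
by move=> a b [].
Qed.

Lemma sum_subs_cons (V : nmodType) (F : seq 'I_k -> V) x t :
  \sum_(p <- subs (x :: t)) F p = \sum_(q <- subs t) F (x :: q) + \sum_(q <- subs t) F q.
Proof. by rewrite /= big_cat big_map. Qed.

Definition shiftn (g : nat -> 'cV[R]_d) n : 'cV[R]_d := if n is m.+1 then g m else 0.

(** [E x] stands for the projection onto block [x] and [D x n] for rho^-(n+1) Q_xx^n extended by
    zero. *)
Variables (Q : 'M[R]_d) (rho : R) (E : 'I_k -> 'M[R]_d) (D : 'I_k -> nat -> 'M[R]_d).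
Hypothesis rho0 : rho != 0.
Hypothesis E_sum : \sum_x E x = 1%:M.
Hypothesis E_low : forall x y, (x < y)%N -> E x *m Q *m E y = 0.
Hypothesis D_0 : forall x, rho *: D x 0%N = E x.
Hypothesis D_S : forall x n, rho *: D x n.+1 = E x *m Q *m D x n.
Hypothesis ED : forall x n, E x *m D x n = D x n.
Hypothesis DE : forall x n, D x n *m E x = D x n.

(** Duhamel's formula for the recursion within block [x] with source [g]; see [resolv0] and
    [resolvS]. *)
Definition resolv x (g : nat -> 'cV[R]_d) n : 'cV[R]_d := \sum_(a < n.+1) D x (n - a)%N *m g a.

Lemma resolv0 x g : rho *: resolv x g 0 = E x *m g 0%N.
Proof. by rewrite /resolv big_ord1 scalemxAl D_0. Qed.

Lemma resolvS x g n :
  rho *: resolv x g n.+1 = E x *m Q *m resolv x g n + E x *m g n.+1.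
Proof.
rewrite /resolv big_ord_recr /= subnn scalerDr scalemxAl D_0; congr (_ + _).
rewrite scaler_sumr mulmx_sumr; apply: eq_bigr => i _.
by rewrite scalemxAl subSn ?D_S ?mulmxA // -ltnS.
Qed.

Lemma resolv_E x g n : E x *m resolv x g n = resolv x g n.
Proof. by rewrite /resolv mulmx_sumr; apply: eq_bigr => i _; rewrite mulmxA ED. Qed.

Lemma resolv_src x g g' n : (forall m, E x *m g m = E x *m g' m) -> resolv x g n = resolv x g' n.
Proof. by move=> gg; apply: eq_bigr => i _; rewrite -(DE x) -!mulmxA gg. Qed.

Lemma resolv_sum x (I : Type) (r : seq I) (g : I -> nat -> 'cV[R]_d) n :
  resolv x (fun m => \sum_(i <- r) g i m) n = \sum_(i <- r) resolv x (g i) n.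
Proof. by rewrite exchange_big; apply: eq_bigr => a _; rewrite mulmx_sumr. Qed.

(** The share of the solution carried by the path: block [x] is fed by its own source and, one step
    later, by the share of [q]. [src] receives the whole remaining path because the source of the
    occupation counts is itself a sum over paths issuing from [l]. *)
Fixpoint path_term (src : seq 'I_k -> nat -> 'cV[R]_d) p : nat -> 'cV[R]_d :=
  if p is x :: q then
    resolv x (fun n => src p n + shiftn (fun m => Q *m path_term src q m) n)
  else fun=> 0.

Lemma path_term_cons src x q n : path_term src (x :: q) n =
  resolv x (fun n => src (x :: q) n + shiftn (fun m => Q *m path_term src q m) n) n.
Proof. by []. Qed.

Lemma path_term_block src x q n :
  E x *m path_term src (x :: q) n = path_term src (x :: q) n.
Proof. exact: resolv_E. Qed.

Section Expansion.
Variables (S : seq 'I_k) (f y : nat -> 'cV[R]_d) (src : seq 'I_k -> nat -> 'cV[R]_d).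
Hypothesis S_uniq : uniq S.
Hypothesis S_low : forall a x t, S = a ++ x :: t -> forall j : 'I_k, (j \in t) = (j < x)%N.
Hypothesis y_0 : rho *: y 0%N = f 0%N.
Hypothesis y_S : forall n, rho *: y n.+1 = Q *m y n + f n.+1.
Hypothesis src_f : forall a x t n, S = a ++ x :: t ->
  E x *m f n = E x *m \sum_(q <- subs t) src (x :: q) n.

(** By triangularity [E x *m Q] reads only blocks j <= x. The term j = x is the recursion of
    [resolv x]; the others, which are the members of [t], act as source. *)
Lemma block_recursion a x t n : S = a ++ x :: t ->
  E x *m y n = resolv x (fun n => f n + shiftn (fun m => Q *m \sum_(j <- t) E j *m y m) n) n.
Proof.
move=> SE; have tu : uniq t by move: S_uniq; rewrite SE cat_uniq => /and3P[_ _ /andP[]].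
have split_Q m : E x *m Q *m y m =
    E x *m Q *m (E x *m y m) + E x *m (Q *m \sum_(j <- t) E j *m y m).
  rewrite -{1}[y m]mul1mx -E_sum mulmx_suml mulmx_sumr (bigD1 x) //=; congr (_ + _).
  rewrite mulmxA mulmx_sumr big_uniq //= big_mkcond [RHS]big_mkcond.
  apply: eq_bigr => j _; rewrite (S_low SE) -val_eqE /=.
  by case: (ltngtP j x) => // xj; rewrite !mulmxA E_low // mul0mx.
elim: n => [|n IH]; apply: (scalerI rho0).
  by rewrite resolv0 /= addr0 scalemxAr y_0.
rewrite resolvS -IH scalemxAr y_S /= !mulmxDr (mulmxA (E x) Q (y n)) split_Q -addrA.
congr (_ + _).
by rewrite addrC.
Qed.

(** Induction on the suffix: linearity of [resolv x] turns the expansion over [t] into the terms of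
    the subsequences that begin with [x]. *)
Lemma sub_expansion a t n : S = a ++ t ->
  \sum_(j <- t) E j *m y n = \sum_(q <- subs t) path_term src q n.
Proof.
elim: t a n => [|x t IH] a n SE; first by rewrite big_nil big_seq1.
have SE' : S = rcons a x ++ t by rewrite SE cat_rcons.
rewrite big_cons sum_subs_cons (IH _ _ SE'); congr (_ + _).
rewrite (block_recursion _ SE) /= -resolv_sum; apply: resolv_src => m.
rewrite !mulmxDr big_split mulmxDr (src_f _ SE); congr (_ + _).
case: m => [|m] /=; first by rewrite big1.
by rewrite (IH _ _ SE') mulmx_sumr.
Qed.

Lemma block_expansion a x t n : S = a ++ x :: t ->
  E x *m y n = \sum_(q <- subs t) path_term src (x :: q) n.
Proof.
move=> SE; have SE' : S = rcons a x ++ t by rewrite SE cat_rcons.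
have := sub_expansion n SE; rewrite big_cons sum_subs_cons (sub_expansion n SE').
by move/addIr.
Qed.

Lemma path_expansion n : (forall j, j \in S) -> y n = \sum_(q <- subs S) path_term src q n.
Proof.
move=> Sall; rewrite -(@sub_expansion [::]) // -mulmx_suml big_uniq //=.
by rewrite (eq_bigl xpredT) ?E_sum ?mul1mx // => j; rewrite Sall.
Qed.
End Expansion.

(** * Growth orders and leading constants of path terms *)

Section Asymptotics.
(** [K x] is the limit of [D x] if [b x] holds and its sum otherwise; in both cases it is the factor
    that convolution puts on the leading constant. *)
Variables (b : 'I_k -> bool) (K : 'I_k -> 'M[R]_d).

Definition asyv h (g : nat -> 'cV[R]_d) (c : 'cV[R]_d) :=
  forall i, asy h (fun n => g n i 0) (c i 0).

Hypothesis D_asy : forall x i j,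
  if b x then asummable (fun n => D x n i j - K x i j)
  else asy 0 (fun n => D x n i j) (K x i j).

Lemma asyv_ext h g g' c : g =1 g' -> asyv h g c -> asyv h g' c.
Proof. by move=> /funext ->. Qed.

Lemma asyv0 h : asyv h (fun=> 0) 0.
Proof. by move=> i; rewrite mxE; apply: asy0. Qed.

Lemma asyvD h g g' c c' : asyv h g c -> asyv h g' c' -> asyv h (fun n => g n + g' n) (c + c').
Proof. by move=> gc gc' i; rewrite mxE; apply: asy_ext (asyD (gc i) (gc' i)) => n; rewrite mxE. Qed.

Lemma asyv_mul h (M : 'M[R]_d) g c : asyv h g c -> asyv h (fun n => M *m g n) (M *m c).
Proof.
move=> gc i; rewrite mxE.
apply: asy_ext (asy_big (index_enum _) (P := xpredT) (fun j _ => asyZ (M i j) (gc j))) => n.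
by rewrite mxE.
Qed.

Lemma asyv_shift h g c : asyv h g c -> asyv h (shiftn g) c.
Proof. by move=> gc i; apply: asy_ext (asy_pred (gc i)) => -[|n]; rewrite ?mxE. Qed.

Lemma asyv_resolv x h g c : asyv h g c -> asyv (b x + h)%N (resolv x g) (K x *m c).
Proof.
move=> gc i; rewrite mxE.
have H j : asy (b x + h)%N (cauchy_prod (fun n => D x n i j) (fun n => g n j 0)) (K x i j * c j 0).
  have := D_asy x i j; case: (b x) => [|[sD DK]]; first by move=> /asy_conv1; apply.
  exact: asy_conv0.
apply: asy_ext (asy_big (index_enum _) (P := xpredT) (fun j _ => H j)) => n.
rewrite /resolv summxE exchange_big; apply: eq_bigr => a _.
by rewrite mxE.
Qed.

(** The all-ones vector enters at time 0 and is credited to one-block paths, so each path receives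
    it once, at its last block. *)
Definition src_one p n : 'cV[R]_d :=
  if (size p == 1)%N && (n == 0)%N then const_mx 1 else 0.

Definition path_order p : nat := count b p.

Fixpoint path_const p : 'cV[R]_d :=
  match p with
  | [::] => 0
  | [:: x] => K x *m const_mx 1
  | x :: q => K x *m (Q *m path_const q)
  end.

Lemma src_one_asyv x q : asyv (path_order q) (src_one (x :: q)) (if q is [::] then const_mx 1 else 0).
Proof.
case: q => [|y q]; last exact: asyv0.
move=> i; have one_sum n : series (fun n => (n == 0%N)%:R : R) n.+1 = 1.
  by rewrite /series /= big_nat_recl //= big1 ?addr0.
have E1 n : (n == 0%N)%:R = src_one [:: x] n i 0.
  by rewrite /src_one /=; case: eqP; rewrite mxE.
apply: (asy_ext E1); rewrite mxE; split.
  rewrite /asummable; apply/cvg_ex; exists 1; rewrite -cvg_shiftS.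
  have -> : (fun n => `|(n == 0%N)%:R|) = (fun n => (n == 0%N)%:R : R).
    by apply/funext => n; rewrite ger0_norm // ler0n.
  by apply: (@cvg_ext _ (fun=> 1)) => [n|]; [exact/esym/one_sum | exact: cvg_cst].
by rewrite -cvg_shiftS; apply: (@cvg_ext _ (fun=> 1)) => [n|]; [exact/esym/one_sum | exact: cvg_cst].
Qed.

Lemma path_term_asyv p : asyv (path_order p) (path_term src_one p) (path_const p).
Proof.
elim: p => [|x q IH]; first exact: asyv0.
have -> : path_const (x :: q) = K x *m ((if q is [::] then const_mx 1 else 0) + Q *m path_const q).
  by case: q {IH} => [|y q] /=; rewrite ?mulmx0 ?addr0 ?add0r.
apply: asyv_resolv; apply: asyvD; first exact: src_one_asyv.
by apply: asyv_shift; apply: asyv_mul.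
Qed.

Variables (l : 'I_k) (Es : 'M[R]_d).
Hypothesis bl : b l.

(* A path meeting [l] uses the resolvent of block [l] twice: in [path_term src_one], which counts the
   time after the visit, and in [path_term src_visit], for the time before it. *)
Definition src_visit p n : 'cV[R]_d :=
  if p is x :: q then if x == l then rho *: (Es *m path_term src_one p n) else 0 else 0.

Fixpoint visit_const p : 'cV[R]_d :=
  if p is x :: q then
    K x *m (if x == l then rho *: (Es *m path_const p) else Q *m visit_const q)
  else 0.

Lemma visit_const_cons x q : visit_const (x :: q) =
  K x *m (if x == l then rho *: (Es *m path_const (x :: q)) else Q *m visit_const q).
Proof. by []. Qed.

Lemma resolv_eq0 x g n : (forall m, E x *m g m = 0) -> resolv x g n = 0.
Proof. by move=> g0; rewrite /resolv big1 // => i _; rewrite -(DE x) -mulmxA g0 mulmx0. Qed.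

Lemma zero_shift x src q n : (forall m, path_term src q m = 0) ->
  E x *m shiftn (fun m => Q *m path_term src q m) n = 0.
Proof. by move=> q0; case: n => [|n]; rewrite /shiftn ?q0 !mulmx0. Qed.

Lemma visit_term_notin p n : l \notin p -> path_term src_visit p n = 0.
Proof.
elim: p n => [//|x q IH] n; rewrite inE negb_or => /andP[lx lq].
rewrite path_term_cons; apply: resolv_eq0 => m.
rewrite /src_visit eq_sym (negbTE lx) add0r; apply: zero_shift => r; exact: IH.
Qed.

(** At [l] the source already has order [path_order], and [resolv l] adds one. Since [p] is
    duplicate-free, the blocks after [l] contribute nothing except through this source. *)
Lemma visit_term_asyv p : uniq p -> l \in p ->
  asyv (path_order p).+1 (path_term src_visit p) (visit_const p).
Proof.
elim: p => [//|x q IH]; rewrite cons_uniq inE eq_sym => /andP[xq uq].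
case: (eqVneq x l) xq => [->|xl] lq lp.
  have H : asyv (path_order (l :: q))
      (fun n => src_visit (l :: q) n + shiftn (fun m => Q *m path_term src_visit q m) n)
      (rho *: (Es *m path_const (l :: q))).
    have ext : (fun n => (rho *: Es) *m path_term src_one (l :: q) n) =1
        (fun n => src_visit (l :: q) n + shiftn (fun m => Q *m path_term src_visit q m) n).
      move=> n; rewrite /src_visit eqxx -scalemxAl.
      by case: n => [|n]; rewrite [shiftn _ _]/= ?visit_term_notin // ?mulmx0 addr0.
    by apply: (asyv_ext ext); rewrite scalemxAl; exact: asyv_mul (path_term_asyv (l :: q)).
  have := asyv_resolv l H; rewrite bl.
  by rewrite (_ : visit_const _ = K l *m (rho *: (Es *m path_const (l :: q)))) //= eqxx.
rewrite visit_const_cons (negbTE xl).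
have -> : (path_order (x :: q)).+1 = (b x + (path_order q).+1)%N by rewrite addnS.
apply: asyv_resolv.
have ext : shiftn (fun m => Q *m path_term src_visit q m) =1
    (fun n => src_visit (x :: q) n + shiftn (fun m => Q *m path_term src_visit q m) n).
  by move=> n; rewrite /src_visit (negbTE xl) add0r.
by apply: (asyv_ext ext); apply: asyv_shift; apply: asyv_mul; apply: IH.
Qed.

Variable link : rel 'I_k.
Hypothesis unlinked : forall x y, ~~ link x y -> E x *m Q *m E y = 0.

Fixpoint linked p : bool :=
  match p with
  | x :: ((y :: _) as q) => link x y && linked q
  | _ => true
  end.

Lemma unlinked_shift src x y q n : E x *m Q *m E y = 0 ->
  E x *m shiftn (fun m => Q *m path_term src (y :: q) m) n = 0.
Proof.
move=> Exy; case: n => [|n]; rewrite /shiftn ?mulmx0 //.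
by rewrite -path_term_block !mulmxA Exy mul0mx.
Qed.

Lemma unlinked_term p n : ~~ linked p -> path_term src_one p n = 0.
Proof.
elim: p n => [//|x [//|y q] IH] n.
rewrite [linked _]/(link x y && linked (y :: q)) negb_and => H.
rewrite path_term_cons; apply: resolv_eq0 => m; rewrite /src_one add0r.
case/orP: H => [/unlinked Exy|H]; first exact: unlinked_shift.
by apply: zero_shift => r; apply: IH.
Qed.

Lemma unlinked_visit p n : ~~ linked p -> path_term src_visit p n = 0.
Proof.
elim: p n => [//|x [//|y q] IH] n pl; rewrite path_term_cons; apply: resolv_eq0 => m.
rewrite mulmxDr.
have -> : src_visit [:: x, y & q] m = 0.
  by rewrite /src_visit; case: eqP => // _; rewrite unlinked_term // mulmx0 scaler0.
rewrite mulmx0 add0r; move: pl.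
rewrite [linked _]/(link x y && linked (y :: q)) negb_and.
case/orP => [/unlinked Exy|H]; first exact: unlinked_shift.
by apply: zero_shift => r; apply: IH.
Qed.

(** * Leading constants for rank-one limits *)

Section RankOne.
Variables (g : 'I_k -> R) (V : 'I_k -> 'cV[R]_d) (U : 'I_k -> 'rV[R]_d) (c : R).
Hypothesis K_VU : forall x, K x = g x *: (V x *m U x).
Hypothesis glrho : g l * rho = 1.
Hypothesis Es_l : (U l *m Es *m V l) 0 0 = c.

Fixpoint path_coef p : R :=
  match p with
  | [::] => 0
  | [:: x] => g x * (U x *m (const_mx 1 : 'cV_d)) 0 0
  | x :: ((y :: _) as q) => g x * (U x *m Q *m V y) 0 0 * path_coef q
  end.

Lemma path_coef_cons x y q :
  path_coef [:: x, y & q] = g x * (U x *m Q *m V y) 0 0 * path_coef (y :: q).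
Proof. by []. Qed.

Lemma rank_one x (w : 'cV[R]_d) : K x *m w = (g x * (U x *m w) 0 0) *: V x.
Proof.
rewrite K_VU -scalemxAl -mulmxA [U x *m w]mx11_scalar mul_mx_scalar scalerA.
by rewrite [in RHS]mxE mulr1n.
Qed.

Lemma path_constE x q : path_const (x :: q) = path_coef (x :: q) *: V x.
Proof.
elim: q x => [|y q IH] x; first by rewrite /= rank_one.
rewrite (_ : path_const _ = K x *m (Q *m path_const (y :: q))) // IH rank_one.
rewrite path_coef_cons.
by rewrite -!scalemxAr mxE mulmxA; congr (_ *: _); ring.
Qed.

(** The second passage through [K l] brings a factor [g l], cancelled by the [rho] of the source,
    and the number u_l E_s v_l = c. The visit thus has the same effect on every path, and [c] leaves
    the sum. *)
Lemma visit_constE x q : l \in x :: q ->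
  visit_const (x :: q) = (c * path_coef (x :: q)) *: V x.
Proof.
have at_l r : visit_const (l :: r) = (c * path_coef (l :: r)) *: V l.
  rewrite (_ : visit_const _ = K l *m (rho *: (Es *m path_const (l :: r)))); last first.
    by rewrite /= eqxx.
  rewrite path_constE rank_one -!scalemxAr; congr (_ *: _).
  rewrite mxE mxE mulmxA Es_l; transitivity (g l * rho * (c * path_coef (l :: r))).
    by ring.
  by rewrite glrho mul1r.
elim: q x => [|y q IH] x; first by rewrite inE => /eqP <-.
rewrite inE; have [<- _|lx lq] := eqVneq l x; first exact: at_l.
rewrite visit_const_cons eq_sym (negbTE lx) (IH y lq) rank_one.
rewrite path_coef_cons.
by rewrite -!scalemxAr mxE mulmxA; congr (_ *: _); ring.
Qed.

End RankOne.
End Asymptotics.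
End PathExpansion.

(** * Occupation counts of the absorbed chain *)

Section Occupation.
Context {R : realType} {d : nat}.
Variable P : 'M[R]_d.+1.
Local Notation Q := (Qof P).

Definition traj n := {ffun 'I_n.+1 -> 'I_d.+1}.

Definition traj_cons n (y : 'I_d.+1) (x : traj n) : traj n.+1 :=
  [ffun i => if unlift ord0 i is Some j then x j else y].

Lemma traj_cons0 n y (x : traj n) : traj_cons y x ord0 = y.
Proof. by rewrite ffunE unlift_none. Qed.

Lemma traj_consS n y (x : traj n) j : traj_cons y x (lift ord0 j) = x j.
Proof. by rewrite ffunE liftK. Qed.

Lemma traj_sum_cons n (p : pred (traj n.+1)) (F : traj n.+1 -> R) :
  \sum_(x | p x) F x = \sum_y \sum_(x | p (traj_cons y x)) F (traj_cons y x).
Proof.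
rewrite pair_big_dep /= (reindex (fun yx : 'I_d.+1 * traj n => traj_cons yx.1 yx.2)) //=.
exists (fun x => (x ord0, [ffun j => x (lift ord0 j)] : traj n)) => [[y x] _|x _] /=.
  by rewrite traj_cons0; congr pair; apply/ffunP => j; rewrite ffunE traj_consS.
apply/ffunP => i; case: (unliftP ord0 i) => [j|] ->; last by rewrite traj_cons0.
by rewrite traj_consS ffunE.
Qed.

(** [path_prob] for an arbitrary initial weight: removing the first state yields a weight of the
    same form, though no longer a probability, so induction on the length applies. *)
Definition traj_weight (phi : 'I_d.+1 -> R) n (x : traj n) : R :=
  phi (x ord0) * \prod_(m < n) P (x (widen_ord (leqnSn n) m)) (x (lift ord0 m)).

Lemma traj_weight_cons phi n y (x : traj n) :
  traj_weight phi (traj_cons y x) = traj_weight (fun z => phi y * P y z) x.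
Proof.
rewrite /traj_weight traj_cons0 big_ord_recl -mulrA; congr (_ * (_ * _)).
  by rewrite (_ : widen_ord _ _ = ord0) ?traj_cons0 ?traj_consS //; apply: val_inj.
apply: eq_bigr => m _; rewrite traj_consS.
by rewrite (_ : widen_ord _ _ = lift ord0 (widen_ord (leqnSn n) m)) ?traj_consS //; apply: val_inj.
Qed.

Lemma not_absorbed_cons n y (x : traj n) :
  not_absorbed (traj_cons y x) = (y != ord0) && not_absorbed x.
Proof.
apply/forallP/andP => [H|[y0 /forallP H] i].
  split; first by have := H ord0; rewrite traj_cons0.
  by apply/forallP => j; have := H (lift ord0 j); rewrite traj_consS.
by case: (unliftP ord0 i) => [j|] ->; rewrite ?traj_consS ?traj_cons0.
Qed.

Lemma occupationE n (x : traj n) s : occupation x s = (\sum_m (x m == s))%N.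
Proof.
by rewrite /occupation -sum1_card big_mkcond; apply: eq_bigr => i _; rewrite inE; case: eqP.
Qed.

Lemma occupation_cons n y (x : traj n) s :
  occupation (traj_cons y x) s = ((y == s) + occupation x s)%N.
Proof.
rewrite !occupationE big_ord_recl traj_cons0; congr addn.
by apply: eq_bigr => i _; rewrite traj_consS.
Qed.

Lemma occupation0 (x : traj 0) s : occupation x s = (x ord0 == s).
Proof.
by rewrite occupationE big_ord1.
Qed.

Definition survival phi n := \sum_(x : traj n | not_absorbed x) traj_weight phi x.

Definition visits phi s n :=
  \sum_(x : traj n | not_absorbed x) traj_weight phi x * (occupation x s)%:R.

Lemma sum_transient (F : 'I_d.+1 -> R) : \sum_(y | y != ord0) F y = \sum_t F (lift ord0 t).
Proof.
by rewrite big_mkcond big_ord_recl /= add0r.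
Qed.

Lemma survivalS phi n :
  survival phi n.+1 = survival (fun z => \sum_t phi (lift ord0 t) * P (lift ord0 t) z) n.
Proof.
rewrite /survival traj_sum_cons.
under eq_bigr => y _ do under eq_bigl do rewrite not_absorbed_cons.
transitivity (\sum_(y | y != ord0) \sum_(x : traj n | not_absorbed x)
    traj_weight phi (traj_cons y x)).
  by rewrite [RHS]big_mkcond; apply: eq_bigr => y _; case: ifP => // _; rewrite big_pred0.
rewrite exchange_big; apply: eq_bigr => x _; rewrite sum_transient [RHS]mulr_suml.
by apply: eq_bigr => t _; rewrite traj_weight_cons.
Qed.

Lemma visitsS phi s n :
  visits phi (lift ord0 s) n.+1 =
    survival (fun z => phi (lift ord0 s) * P (lift ord0 s) z) n +
    visits (fun z => \sum_t phi (lift ord0 t) * P (lift ord0 t) z) (lift ord0 s) n.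
Proof.
rewrite /visits /survival traj_sum_cons.
under eq_bigr => y _ do under eq_bigl do rewrite not_absorbed_cons.
transitivity (\sum_(y | y != ord0) \sum_(x : traj n | not_absorbed x)
    traj_weight phi (traj_cons y x) * (occupation (traj_cons y x) (lift ord0 s))%:R).
  by rewrite [RHS]big_mkcond; apply: eq_bigr => y _; case: ifP => // _; rewrite big_pred0.
rewrite exchange_big -big_split; apply: eq_bigr => x _; rewrite sum_transient /=.
under eq_bigr do rewrite traj_weight_cons occupation_cons natrD mulrDr.
rewrite big_split /=; congr (_ + _); last by rewrite -mulr_suml -mulr_suml.
rewrite (bigD1 s) //= eqxx mulr1 big1 ?addr0 // => t ts.
by rewrite (inj_eq (@lift_inj _ ord0)) (negbTE ts) mulr0.
Qed.

Lemma sum_traj0 (F : traj 0 -> R) :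
  \sum_(x : traj 0 | not_absorbed x) F x = \sum_t F [ffun=> lift ord0 t].
Proof.
rewrite -(sum_transient (fun y => F [ffun=> y])).
rewrite (reindex (fun y : 'I_d.+1 => [ffun=> y] : traj 0)); last first.
  exists (fun x : traj 0 => x ord0) => [y _|x _]; first by rewrite ffunE.
  by apply/ffunP => i; rewrite ffunE (ord1 i).
apply: eq_bigl => y; apply/forallP/idP => [/(_ ord0)|y0 i]; by rewrite ffunE.
Qed.

Lemma sum_Qof (phi : 'I_d.+1 -> R) (w : 'cV[R]_d) :
  \sum_z (\sum_t phi (lift ord0 t) * P (lift ord0 t) (lift ord0 z)) * w z 0 =
  \sum_t phi (lift ord0 t) * (Q *m w) t 0.
Proof.
under eq_bigr do rewrite mulr_suml.
rewrite exchange_big; apply: eq_bigr => t _; rewrite mxE mulr_sumr.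
by apply: eq_bigr => z _; rewrite mxE mulrA.
Qed.

Lemma survivalE phi n :
  survival phi n = \sum_t phi (lift ord0 t) * (Q ^+ n *m const_mx 1 : 'cV_d) t 0.
Proof.
elim: n phi => [|n IH] phi.
  rewrite expr0 mul1mx /survival sum_traj0; apply: eq_bigr => t _.
  by rewrite /traj_weight big_ord0 ffunE mxE.
by rewrite survivalS IH sum_Qof exprS -mulmxE -mulmxA.
Qed.

Lemma delta_mulE (s t : 'I_d) (w : 'cV[R]_d) : (delta_mx s s *m w) t 0 = (t == s)%:R * w s 0.
Proof.
rewrite mxE (bigD1 s) //= mxE eqxx andbT big1 ?addr0 // => i si.
by rewrite mxE (negbTE si) andbF mul0r.
Qed.

Lemma sum_Qof_row (phi : 'I_d.+1 -> R) s (w : 'cV[R]_d) :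
  \sum_t phi (lift ord0 t) * (delta_mx s s *m (Q *m w)) t 0 =
  \sum_z phi (lift ord0 s) * P (lift ord0 s) (lift ord0 z) * w z 0.
Proof.
rewrite (bigD1 s) //= big1 ?addr0 => [|t ts]; last first.
  by rewrite delta_mulE (negbTE ts) mul0r mulr0.
rewrite delta_mulE eqxx mul1r mxE mulr_sumr.
by apply: eq_bigr => z _; rewrite mxE mulrA.
Qed.

(** Horner form of sum_(m <= n) Q^m E_s Q^(n-m) 1, which exhibits the recursion in [n]. *)
Fixpoint visit_vec (s : 'I_d) n : 'cV[R]_d :=
  delta_mx s s *m (Q ^+ n *m const_mx 1) + (if n is m.+1 then Q *m visit_vec s m else 0).

Lemma visit_vecS s n t : visit_vec s n.+1 t 0 =
  (delta_mx s s *m (Q ^+ n.+1 *m (const_mx 1 : 'cV_d))) t 0 + (Q *m visit_vec s n) t 0.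
Proof. by rewrite mxE. Qed.

Lemma visitsE phi s n :
  visits phi (lift ord0 s) n = \sum_t phi (lift ord0 t) * visit_vec s n t 0.
Proof.
elim: n phi => [|n IH] phi.
  rewrite /visits sum_traj0; apply: eq_bigr => t _; rewrite /= addr0 delta_mulE.
  rewrite expr0 mul1mx /traj_weight big_ord0 occupation0 !ffunE mxE !mulr1.
  by rewrite (inj_eq (@lift_inj _ ord0)).
rewrite visitsS IH survivalE sum_Qof -sum_Qof_row.
rewrite -big_split /=; apply: eq_bigr => t _; rewrite visit_vecS mulrDr.
by rewrite exprS -mulmxE -mulmxA.
Qed.

End Occupation.

(** * Block structure and admissible paths *)

Section BlockMatrices.
Context {R : realType} {d k : nat}.
Variables (blk : 'I_d -> 'I_k) (Q : 'M[R]_d).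
Local Notation I := (Iset blk).

(** The inclusion of the coordinates of block [i]. It moves blocks of varying size into ['M[R]_d],
    where their products along a path are formed. *)
Definition block_incl i : 'M[R]_(d, #|I i|) := \matrix_(s, a) (s == enum_val a)%:R.
Local Notation J := block_incl.

Lemma tr_incl_mul i m (M : 'M[R]_(d, m)) a t : ((J i)^T *m M) a t = M (enum_val a) t.
Proof.
rewrite mxE (bigD1 (enum_val a)) //= !mxE eqxx mul1r big1 ?addr0 // => s sa.
by rewrite !mxE (negbTE sa) mul0r.
Qed.

Lemma mul_incl i m (M : 'M[R]_(m, d)) t a : (M *m J i) t a = M t (enum_val a).
Proof.
rewrite mxE (bigD1 (enum_val a)) //= !mxE eqxx mulr1 big1 ?addr0 // => s sa.
by rewrite !mxE (negbTE sa) mulr0.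
Qed.

Lemma blk_enum_val i (a : 'I_#|I i|) : blk (enum_val a) = i.
Proof. by have := enum_valP a; rewrite inE => /eqP. Qed.

Lemma QblkE i j : Qblk blk Q i j = (J i)^T *m Q *m J j.
Proof. by apply/matrixP => a b; rewrite mul_incl tr_incl_mul mxE. Qed.

Lemma tr_incl_incl i : (J i)^T *m J i = 1%:M.
Proof.
by apply/matrixP => a b; rewrite tr_incl_mul !mxE (inj_eq enum_val_inj).
Qed.

Lemma tr_incl_incl_neq i j : i != j -> (J i)^T *m J j = 0.
Proof.
move=> ij; apply/matrixP => a b; rewrite tr_incl_mul !mxE.
case: eqP => // E; case/eqP: ij; by rewrite -(blk_enum_val a) E blk_enum_val.
Qed.

Definition block_proj i : 'M[R]_d := J i *m (J i)^T.
Local Notation E := block_proj.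

Lemma block_projE i s t : E i s t = ((s == t) && (blk s == i))%:R.
Proof.
have [si|si] := boolP (blk s == i); last first.
  rewrite andbF mxE big1 // => a _; rewrite !mxE; case: eqP => [sa|]; last by rewrite mul0r.
  by case/eqP: si; rewrite sa blk_enum_val.
have sI : s \in I i by rewrite inE.
have -> : s = enum_val (enum_rank_in sI s) by rewrite enum_rankK_in.
rewrite andbT -(tr_incl_mul (J i *m (J i)^T)) mulmxA tr_incl_incl mul1mx !mxE.
by rewrite eq_sym.
Qed.

Lemma block_proj_sum : \sum_i E i = 1%:M.
Proof.
apply/matrixP => s t; rewrite summxE mxE (bigD1 (blk s)) //= block_projE eqxx andbT.
by rewrite big1 ?addr0 // => i si; rewrite block_projE (eq_sym (blk s)) (negbTE si) andbF.
Qed.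

Lemma block_proj_sandwich i j : E i *m Q *m E j = J i *m Qblk blk Q i j *m (J j)^T.
Proof. by rewrite QblkE !mulmxA. Qed.

Lemma block_proj_low (low : forall s t, (blk s < blk t)%N -> Q s t = 0) (i j : 'I_k) :
  (i < j)%N -> E i *m Q *m E j = 0.
Proof.
move=> ij; rewrite block_proj_sandwich (_ : Qblk _ _ _ _ = 0) ?mulmx0 ?mul0mx //.
by apply/matrixP => a b; rewrite !mxE low // !blk_enum_val.
Qed.

Lemma delta_incl i (a : 'I_#|I i|) :
  delta_mx (enum_val a) (enum_val a) = J i *m delta_mx a a *m (J i)^T.
Proof.
apply/matrixP => s t; rewrite mxE [RHS]mxE (bigD1 a) //= big1 => [|b ba]; last first.
  by rewrite mxE big1 ?mul0r // => c _; rewrite !mxE (negbTE ba) andbF mulr0.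
rewrite addr0 mxE (bigD1 a) //= big1 => [|b ba]; last first.
  by rewrite !mxE (negbTE ba) mulr0.
by rewrite addr0 !mxE !eqxx mulr1 -natrM mulnb.
Qed.

End BlockMatrices.

(** * Strictly decreasing sequences as subsequences of the reversed enumeration *)

Section DecreasingSequences.
Variable k : nat.
Local Notation S := (rev (enum 'I_k)).

Lemma rev_enum_uniq : uniq S. Proof. by rewrite rev_uniq enum_uniq. Qed.

Lemma mem_rev_enum j : j \in S. Proof. by rewrite mem_rev mem_enum. Qed.

Lemma rev_enum_low a (x : 'I_k) t : S = a ++ x :: t -> forall j : 'I_k, (j \in t) = (j < x)%N.
Proof.
move=> SE j; have tr : transitive (fun i j : 'I_k => (j < i)%N).
  by move=> y z w yz wy; exact: ltn_trans wy yz.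
have : pairwise (fun i j : 'I_k => (j < i)%N) S.
  rewrite -sorted_pairwise // rev_sorted.
  by have := iota_ltn_sorted 0 k; rewrite -val_enum_ord sorted_map.
rewrite SE pairwise_cat pairwise_cons => /and3P[/allrelP ax _ /andP[/allP xt _]].
apply/idP/idP => [/xt //|jx].
have := mem_rev_enum j; rewrite SE mem_cat inE => /or3P[ja|/eqP jx'|//].
  by have := ax _ _ ja (mem_head _ _); rewrite ltnNge (ltnW jx).
by rewrite jx' ltnn in jx.
Qed.

(** Bridge between paths encoded by sets and paths produced by the expansion: a subsequence of a
    duplicate-free list is the list filtered by its members. *)
Lemma mem_dec_seqs (p : seq 'I_k) : (p \in dec_seqs k) = (p != [::]) && (p \in subs S).
Proof.
have enumE (A : {set 'I_k}) : enum A = [seq x <- enum 'I_k | x \in A].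
  by rewrite !enumT.
rewrite mem_subs; apply/mapP/andP => [[A]|[p0 pS]].
  rewrite mem_filter => /andP[A0 _] ->; split.
    by rewrite -size_eq0 size_rev -cardE -lt0n.
  by rewrite subseq_rev enumE filter_subseq.
exists [set x in p].
  rewrite mem_filter mem_enum andbT; case: p p0 {pS} => // x p _.
  by rewrite card_gt0; apply/set0Pn; exists x; rewrite inE mem_head.
rewrite -[p in LHS]revK; congr rev; rewrite enumE.
have : subseq (rev p) (enum 'I_k) by rewrite -subseq_rev revK.
move/(subseq_uniqP (enum_uniq _)) => E; rewrite {1}E.
by apply: eq_filter => x; rewrite !inE mem_rev.
Qed.

Lemma dec_seqs_uniq : uniq (dec_seqs k).
Proof.
rewrite map_inj_uniq ?filter_uniq -?enumT ?enum_uniq // => A B /(congr1 rev); rewrite !revK => AB.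
by apply/setP => x; rewrite -[LHS]mem_enum AB mem_enum.
Qed.

Lemma sum_mem_seq (T : eqType) (V : nmodType) (s r : seq T) (F : T -> V) :
  uniq s -> uniq r -> {subset r <= s} -> \sum_(q <- s) (if q \in r then F q else 0) = \sum_(q <- r) F q.
Proof.
move=> us ur rs; rewrite -big_mkcond -big_filter; apply: perm_big; apply: uniq_perm => //.
  exact: filter_uniq.
move=> q; rewrite mem_filter; case: (boolP (q \in r)) => // /rs ->; by [].
Qed.

Lemma sum_src_one (R : realType) d t (x : 'I_k) n :
  \sum_(q <- subs t) src_one (x :: q) n = src_one [:: x] n :> 'cV[R]_d.
Proof.
elim: t => [|y t IH]; first by rewrite big_seq1.
by rewrite sum_subs_cons IH big1 ?add0r.
Qed.

End DecreasingSequences.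

(** * Asymptotics of the block path sums *)

Lemma asy_sandwich (R : realType) m p q t h (A : 'M[R]_(m, p)) (B : 'M[R]_(q, t)) (X : nat -> 'M[R]_(p, q))
    (L : 'M[R]_(p, q)) :
  (forall a b, asy h (fun n => X n a b) (L a b)) ->
  forall i j, asy h (fun n => (A *m X n *m B) i j) ((A *m L *m B) i j).
Proof.
move=> XL i j.
have AX c : asy h (fun n => (A *m X n) i c) ((A *m L) i c).
  rewrite mxE; apply: asy_ext (asy_big (index_enum _) (P := xpredT) (fun a _ => asyZ (A i a) (XL a c))) => n.
  by rewrite mxE.
have -> : (A *m L *m B) i j = \sum_c B c j * (A *m L) i c.
  by rewrite mxE; apply: eq_bigr => c _; rewrite mulrC.
apply: asy_ext (asy_big (index_enum _) (P := xpredT) (fun c _ => asyZ (B c j) (AX c))) => n.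
by rewrite [RHS]mxE; apply: eq_bigr => c _; rewrite mulrC.
Qed.

Lemma scalar_mxX (R : realType) n (c : R) m : (c%:M : 'M[R]_n) ^+ m = (c ^+ m)%:M.
Proof.
elim: m => [|m IH]; first by rewrite !expr0.
by rewrite !exprS IH -mulmxE mul_scalar_mx scale_scalar_mx.
Qed.

(** Powers of a scalar matrix vanish off the diagonal, so eventual positivity forces dimension 1,
    where the normalisations give w = x = 1. *)
Lemma perron_scalar (R : realType) n (A : 'M[R]_n) a w x : perron A a w -> left_perron A a w x ->
  is_scalar_mx A -> A = a%:M /\ w *m x = 1%:M.
Proof.
move=> pA [_ xw] /is_scalar_mxP[c Ac]; have [a0 _] := perron_index pA.
have [_ [m Am] w0 Aw w1] := pA.
have one (i j : 'I_n) : i = j.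
  apply/eqP; have := Am m (leqnn m) i j.
  have -> : A ^+ m = (c ^+ m)%:M by rewrite Ac scalar_mxX.
  by rewrite mxE; case: eqP => //; rewrite mulr0n ltxx.
have ca : c = a.
  have := congr1 (fun z : 'cV_n => z a0 0) Aw; rewrite Ac mul_scalar_mx !mxE.
  by move/mulIf; apply; rewrite gt_eqF.
split; first by rewrite Ac ca.
have wa : w a0 0 = 1.
  rewrite -[RHS]w1 (bigD1 a0) //= big1 ?addr0 // => i; by rewrite (one i a0) eqxx.
apply/matrixP => i j; rewrite (one i a0) (one j a0) mxE big_ord1 wa mul1r mxE eqxx.
rewrite -[RHS]xw mxE (bigD1 a0) //= big1 ?addr0 ?wa ?mulr1 // => h.
by rewrite (one h a0) eqxx.
Qed.

Section BlockAsymptotics.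
Context {R : realType} {d k : nat}.
Variables (blk : 'I_d -> 'I_k) (Q : 'M[R]_d) (rho : 'I_k -> R).
Variables (v : forall i : 'I_k, 'cV[R]_(#|Iset blk i|)) (u : forall i : 'I_k, 'rV[R]_(#|Iset blk i|)).
Local Notation J := (block_incl blk).
Local Notation E := (block_proj blk).
Local Notation QB i := (Qblk blk Q i i).
Local Notation r := (rho_max rho).
Local Notation S := (rev (enum 'I_k)).
Hypothesis low : forall s t, (blk s < blk t)%N -> Q s t = 0.
Hypothesis pQ : forall i, perron (QB i) (rho i) (v i).
Hypothesis lu : forall i, left_perron (QB i) (rho i) (v i) (u i).
Hypothesis scalar_block : forall i, rho i < r -> is_scalar_mx (QB i).

Lemma rho_gt0 i : 0 < rho i. Proof. exact: perron_root_gt0 (pQ i). Qed.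

Lemma rho_le_max i : rho i <= r. Proof. exact: le_bigmax_cond. Qed.

Definition top i := rho i == r.

Lemma topN i : ~~ top i -> rho i < r.
Proof. by rewrite lt_neqAle rho_le_max andbT. Qed.

Variable l : 'I_k.
Hypothesis rho_l : rho l = r.

Lemma r_gt0 : 0 < r. Proof. by rewrite -rho_l rho_gt0. Qed.

Lemma r_neq0 : r != 0. Proof. by rewrite gt_eqF ?r_gt0. Qed.

(** The limit 1/r of r^-(n+1) rho_i^n if rho_i = r, and otherwise the sum 1/(r - rho_i) of this
    geometric series. *)
Definition rate i := if top i then r^-1 else (r - rho i)^-1.

Definition kernel_block i n := r^-1 ^+ n.+1 *: QB i ^+ n.

Definition kernel i n : 'M[R]_d := J i *m kernel_block i n *m (J i)^T.

Definition kernel_lim i : 'M[R]_d := rate i *: ((J i *m v i) *m (u i *m (J i)^T)).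

Lemma kernel_limE i : kernel_lim i = rate i *: ((J i *m v i) *m (u i *m (J i)^T)).
Proof. by []. Qed.

Lemma kernel_0 i : r *: kernel i 0 = E i.
Proof.
rewrite /kernel /kernel_block expr1 expr0 -scalemxAr -scalemxAl scalerA divff ?r_neq0 //.
by rewrite scale1r mulmx1.
Qed.

Lemma kernel_S i n : r *: kernel i n.+1 = E i *m Q *m kernel i n.
Proof.
rewrite /kernel /kernel_block -!scalemxAr -!scalemxAl -scalemxAr scalerA.
rewrite (exprS _ n.+1) mulrA divff ?r_neq0 // mul1r; congr (_ *: _).
by rewrite exprS -mulmxE QblkE /block_proj !mulmxA.
Qed.

Lemma proj_kernel i n : E i *m kernel i n = kernel i n.
Proof. by rewrite /kernel /block_proj !mulmxA -(mulmxA (J i)) tr_incl_incl mulmx1. Qed.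

Lemma kernel_proj i n : kernel i n *m E i = kernel i n.
Proof.
by rewrite /kernel /block_proj -!mulmxA (mulmxA _ (J i) (J i)^T) tr_incl_incl mul1mx.
Qed.

Lemma kernel_asy i s t :
  if top i then asummable (fun n => kernel i n s t - kernel_lim i s t)
  else asy 0 (fun n => kernel i n s t) (kernel_lim i s t).
Proof.
have limE : kernel_lim i = J i *m (rate i *: (v i *m u i)) *m (J i)^T.
  by rewrite /kernel_lim -scalemxAr -scalemxAl !mulmxA.
rewrite limE; case: ifPn => ti.
  have -> : rate i = r^-1 by rewrite /rate ti.
  move/eqP: ti => ti.
  pose X n := kernel_block i n - r^-1 *: (v i *m u i).
  have XE a b n : X n a b = r^-1 * ((QB i ^+ n) a b / rho i ^+ n - v i a 0 * u i 0 b).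
    rewrite /X /kernel_block mxE [X in _ + X]mxE !mxE big_ord1 exprS ti exprVn.
    by rewrite mulrBr mulrA mulrAC -mulrA.
  (* Only summability matters; the sum is named because [asy_sandwich] transports it along. *)
  have Xs a b : asy 0 (fun n => X n a b) (limn (series (fun n => X n a b))).
    have s0 := perron_summable (a := a) (b := b) (pQ i) (lu i).
    have [s1 s1l] := asyZ r^-1 (conj s0 (normed_cvg s0) : asy 0 _ _).
    have E1 : (fun n => r^-1 * ((QB i ^+ n) a b / rho i ^+ n - v i a 0 * u i 0 b)) =
       (fun n => X n a b) by apply/funext => n; rewrite XE.
    rewrite E1 in s1 s1l; split=> //; exact: normed_cvg s1.
  have [H0 _] := asy_sandwich (J i) (J i)^T (L := \matrix_(a, b) limn (series (fun n => X n a b)))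
    (fun a b => eq_ind_r (asy 0 _) (Xs a b) (mxE _ _ _ _)) s t.
  have XK n : (J i *m X n *m (J i)^T) s t =
      kernel i n s t - (J i *m (r^-1 *: (v i *m u i)) *m (J i)^T) s t.
    by rewrite /X mulmxBr mulmxBl [LHS]mxE [X in _ + X = _]mxE.
  rewrite (_ : (fun n => _) = fun n => (J i *m X n *m (J i)^T) s t); first exact: H0.
  by apply/funext => n; rewrite XK.
have -> : rate i = (r - rho i)^-1 by rewrite /rate (negbTE ti).
have {}ti := topN ti; have [QS vu1] := perron_scalar (pQ i) (lu i) (scalar_block ti).
apply: (asy_sandwich (J i) (J i)^T (X := kernel_block i) (L := (r - rho i)^-1 *: (v i *m u i))) => a b.
rewrite vu1 !mxE.
have q1 : `|rho i / r| < 1.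
  by rewrite ger0_norm ?divr_ge0 ?(ltW r_gt0) ?(ltW (rho_gt0 i)) // ltr_pdivrMr ?r_gt0 // mul1r.
have XE n : (a == b)%:R * geometric r^-1 (rho i / r) n = kernel_block i n a b.
  rewrite /kernel_block QS scalar_mxX !mxE /= exprS exprVn exprMn exprVn.
  by case: eqP => _; rewrite ?mulr1n ?mulr0n ?mul1r ?mul0r ?mulr0 // -mulrA [_^-1 * rho i ^+ n]mulrC.
have -> : (r - rho i)^-1 * (a == b)%:R = (a == b)%:R * (r^-1 / (1 - rho i / r)).
  rewrite mulrC; congr (_ * _); rewrite -[RHS]invfM mulrBr mulr1 mulrCA divff ?r_neq0 //.
  by rewrite mulr1.
apply: (asy_ext XE); apply: asyZ; split; last exact: cvg_geometric_series.
rewrite /asummable; have -> : (fun n => `|geometric r^-1 (rho i / r) n|) = geometric r^-1 (rho i / r).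
  apply/funext => n; rewrite ger0_norm //= mulr_ge0 ?invr_ge0 ?(ltW r_gt0) //.
  by rewrite exprn_ge0 // divr_ge0 ?(ltW r_gt0) ?(ltW (rho_gt0 i)).
exact: is_cvg_geometric_series.
Qed.

Definition link i j := Qblk blk Q i j != 0.

Lemma unlinked_proj i j : ~~ link i j -> E i *m Q *m E j = 0.
Proof. by rewrite negbK block_proj_sandwich => /eqP ->; rewrite mulmx0 mul0mx. Qed.

Lemma linkedE p : linked link p = admissible_links blk Q p.
Proof.
by elim: p => [//|x [//|y q] IH]; rewrite [RHS]/(link x y && admissible_links blk Q (y :: q)) -IH.
Qed.

Local Notation term := (path_term Q kernel (@src_one R d k)).

Definition scaled_tail n : 'cV[R]_d := r^-1 ^+ n.+1 *: (Q ^+ n *m const_mx 1).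

Lemma scaled_tail0 : r *: scaled_tail 0 = const_mx 1.
Proof. by rewrite /scaled_tail expr1 expr0 mul1mx scalerA divff ?r_neq0 // scale1r. Qed.

Lemma scaled_tailS n : r *: scaled_tail n.+1 = Q *m scaled_tail n.
Proof.
rewrite /scaled_tail scalerA (exprS _ n.+1) mulrA divff ?r_neq0 // mul1r.
by rewrite (exprS Q) -mulmxE -mulmxA scalemxAr.
Qed.

Lemma src_one_tail a x t n : S = a ++ x :: t ->
  E x *m (if n == 0%N then const_mx 1 else 0) = E x *m \sum_(q <- subs t) src_one (x :: q) n :> 'cV[R]_d.
Proof. by rewrite sum_src_one. Qed.

Lemma tail_block a x t n : S = a ++ x :: t ->
  E x *m scaled_tail n = \sum_(q <- subs t) term (x :: q) n.
Proof.
move=> SE; apply: (block_expansion (y := scaled_tail) (f := fun n => if n == 0%N then const_mx 1 else 0)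
  r_neq0 (block_proj_sum blk) (block_proj_low low) kernel_0 kernel_S
  kernel_proj (rev_enum_uniq k) (@rev_enum_low k) scaled_tail0 _ src_one_tail n SE) => m.
by rewrite scaled_tailS addr0.
Qed.

Lemma tail_expansion n : scaled_tail n = \sum_(q <- subs S) term q n.
Proof.
apply: (path_expansion r_neq0 (block_proj_sum blk) (block_proj_low low) kernel_0 kernel_S
  kernel_proj (rev_enum_uniq k) (@rev_enum_low k) scaled_tail0 _ src_one_tail) => [m|j].
  by rewrite scaled_tailS addr0.
exact: mem_rev_enum.
Qed.

(** * Expansion of the occupation counts of a state of block l *)

Variable a : 'I_#|Iset blk l|.
Local Notation s := (enum_val a).
Local Notation Es := (delta_mx s s : 'M[R]_d).
Local Notation vterm := (path_term Q kernel (src_visit Q r kernel l Es)).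

Variable vv : nat -> 'cV[R]_d.
Hypothesis vv0 : vv 0 = Es *m const_mx 1.
Hypothesis vvS : forall n, vv n.+1 = Es *m (Q ^+ n.+1 *m const_mx 1) + Q *m vv n.

(** The scaling agrees with that of [scaled_tail], so it cancels in the quotient; multiplying the
    recursion by [r] leaves the factor [r] in the source. *)
Definition scaled_visits n : 'cV[R]_d := r^-1 ^+ n.+1 *: vv n.

Lemma scaled_visits0 : r *: scaled_visits 0 = r *: (Es *m scaled_tail 0).
Proof. by rewrite /scaled_visits vv0 /scaled_tail expr0 mul1mx scalemxAr. Qed.

Lemma scaled_visitsS n :
  r *: scaled_visits n.+1 = Q *m scaled_visits n + r *: (Es *m scaled_tail n.+1).
Proof.
rewrite /scaled_visits vvS scalerDr scalerDr addrC -!scalemxAr; congr (_ + _).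
by rewrite scalerA (exprS _ n.+1) mulrA divff ?r_neq0 // mul1r.
Qed.

(** The state lies in block [l], so E_x E_s = 0 for x <> l, while E_s = E_s E_l lets [tail_block]
    expand the source along paths starting at [l]. *)
Lemma visits_src b x t n : S = b ++ x :: t ->
  E x *m (r *: (Es *m scaled_tail n)) =
  E x *m \sum_(q <- subs t) src_visit Q r kernel l Es (x :: q) n.
Proof.
move=> SE; rewrite /src_visit; case: eqP => [xl|/eqP xl]; last first.
  rewrite big1 // mulmx0 delta_incl -scalemxAr /block_proj !mulmxA -(mulmxA (J x)).
  by rewrite tr_incl_incl_neq // mulmx0 !mul0mx scaler0.
rewrite -scaler_sumr -mulmx_sumr -(tail_block n SE) xl; congr (_ *m (_ *: _)).
by rewrite mulmxA delta_incl /block_proj -!mulmxA (mulmxA _ (J l)) tr_incl_incl mul1mx.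
Qed.

Lemma visits_expansion n : scaled_visits n = \sum_(q <- subs S) vterm q n.
Proof.
apply: (path_expansion (f := fun n => r *: (Es *m scaled_tail n)) r_neq0 (block_proj_sum blk)
  (block_proj_low low) kernel_0 kernel_S
  kernel_proj (rev_enum_uniq k) (@rev_enum_low k) scaled_visits0 scaled_visitsS visits_src).
exact: mem_rev_enum.
Qed.

Local Notation path_const := (path_const Q kernel_lim).
Local Notation path_coef :=
  (path_coef Q rate (fun i => J i *m v i) (fun i => u i *m (J i)^T)).
Local Notation visit_const := (visit_const Q r kernel_lim l Es).
Local Notation Pm := (Pmax blk Q rho).
Local Notation Pl := (Pmax_l blk Q rho l).
Local Notation hm := (hplus_max blk Q rho).

Lemma top_l : top l. Proof. by rewrite /top rho_l. Qed.

Lemma rho_path_max p : (0 < count top p)%N -> rho_path rho p = r.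
Proof.
rewrite -has_count => /hasP[i ip /eqP ti]; apply: le_anti; apply/andP; split.
  by apply: bigmax_le => [|j _]; [exact: ltW r_gt0 | exact: rho_le_max].
by rewrite -{1}ti; apply: le_bigmax_seq.
Qed.

Lemma hplus_count p : rho_path rho p = r -> hplus rho p = count top p.
Proof. by move=> pr; rewrite /hplus pr. Qed.

Lemma mem_adm_paths p : (p \in adm_paths blk Q) = [&& p != [::], p \in subs S & linked link p].
Proof. by rewrite mem_filter linkedE mem_dec_seqs andbC andbA. Qed.

(** A path with at least one top block has rho(theta) = rho_max, so for positive [hm] the count
    alone decides maximality. *)
Lemma mem_PmaxE p : (0 < hm)%N ->
  (p \in Pm) = [&& p != [::], p \in subs S, linked link p & count top p == hm].
Proof.
move=> hm0; rewrite mem_filter mem_adm_paths andbC -!andbA; do 3 congr (_ && _).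
apply/andP/eqP => [[/eqP <- /eqP pr]|ph]; first by rewrite hplus_count.
have pr : rho_path rho p = r by apply: rho_path_max; rewrite ph.
by rewrite hplus_count // ph pr !eqxx.
Qed.

Lemma count_le_hplus_max p : p != [::] -> p \in subs S -> linked link p ->
  (count top p <= hm)%N.
Proof.
move=> p0 pS pl; have [->//|c0] := posnP (count top p).
have pr := rho_path_max c0; rewrite -(hplus_count pr).
by apply: leq_bigmax_seq; rewrite ?pr // mem_adm_paths p0 pS.
Qed.

Lemma hplus_max_gt0 : Pl != [::] -> (0 < hm)%N.
Proof.
case E0 : Pl => [//|p t] _; have : p \in Pl by rewrite E0 mem_head.
rewrite mem_filter => /andP[lp]; rewrite mem_filter => /andP[/andP[/eqP <- /eqP pr] _].
by rewrite hplus_count // -has_count; apply/hasP; exists l => //; exact: top_l.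
Qed.

Lemma Pmax_uniq : uniq Pm.
Proof. by rewrite filter_uniq // filter_uniq // dec_seqs_uniq. Qed.

Variable pi : 'I_d -> R.

Definition pi_dot (w : 'cV[R]_d) : R := \sum_t pi t * w t 0.

Lemma pi_dotZ c w : pi_dot (c *: w) = c * pi_dot w.
Proof. by rewrite mulr_sumr; apply: eq_bigr => t _; rewrite mxE mulrCA. Qed.

Lemma pi_dot_sum (T : Type) (q : seq T) (F : T -> 'cV[R]_d) :
  pi_dot (\sum_(i <- q) F i) = \sum_(i <- q) pi_dot (F i).
Proof.
rewrite exchange_big; apply: eq_bigr => t _; rewrite summxE mulr_sumr; exact: eq_bigr.
Qed.

Lemma pi_dot_incl i (x : 'cV[R]_(#|Iset blk i|)) : pi_dot (J i *m x) = pi_v pi x.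
Proof.
pose p : 'rV[R]_d := \row_t pi t.
have -> : pi_dot (J i *m x) = (p *m (J i *m x)) 0 0.
  by rewrite [RHS]mxE; apply: eq_bigr => t _; rewrite [p _ _]mxE.
rewrite mulmxA mxE; apply: eq_bigr => b _; by rewrite mul_incl mxE.
Qed.

Lemma pi_dot_asy h (x : nat -> 'cV[R]_d) c : asyv h x c -> asy h (pi_dot \o x) (pi_dot c).
Proof.
by move=> xc; apply: asy_ext (asy_big (index_enum _) (P := xpredT) (fun t _ => asyZ (pi t) (xc t))).
Qed.

(** All subsequences are assigned order [hm]: empty and unlinked ones vanish, and those with fewer
    top blocks have constant 0. *)
Lemma tail_asy : (0 < hm)%N ->
  asy hm (pi_dot \o scaled_tail) (\sum_(p <- Pm) pi_dot (path_const p)).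
Proof.
move=> hm0; rewrite -(sum_mem_seq (s := subs S)) ?subs_uniq ?rev_enum_uniq ?Pmax_uniq //; last first.
  by move=> p; rewrite mem_PmaxE // => /and3P[].
have E0 : (fun n => \sum_(p <- subs S) pi_dot (term p n)) =1 pi_dot \o scaled_tail.
  by move=> n; rewrite /= tail_expansion pi_dot_sum.
apply: (asy_ext E0); rewrite big_seq.
have E1 : (fun n => \sum_(p <- subs S | p \in subs S) pi_dot (term p n)) =1
  (fun n => \sum_(p <- subs S) pi_dot (term p n)) by move=> n; rewrite -big_seq.
apply: (asy_ext E1); apply: asy_big => p pS.
rewrite mem_PmaxE // pS /=; have [->|p0] := eqVneq p [::].
  apply: asy_ext (asy0 _) => n; rewrite /pi_dot big1 // => t _; by rewrite mxE mulr0.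
have [pl|pl] := boolP (linked link p); last first.
  apply: asy_ext (asy0 _) => n; rewrite (unlinked_term proj_kernel kernel_proj unlinked_proj) //.
  by rewrite /pi_dot big1 // => t _; rewrite mxE mulr0.
have H := pi_dot_asy (path_term_asyv Q kernel_asy p).
case: eqP => [ph|/eqP ph] /=; first by rewrite -ph.
by apply: asy_lt H _; rewrite ltn_neqAle ph count_le_hplus_max.
Qed.

Lemma visits_asy : (0 < hm)%N ->
  asy hm.+1 (pi_dot \o scaled_visits) (\sum_(p <- Pl) pi_dot (visit_const p)).
Proof.
move=> hm0; have Pl_uniq : uniq Pl by rewrite filter_uniq ?Pmax_uniq.
have Pl_subs : {subset Pl <= subs S}.
  by move=> p; rewrite mem_filter => /andP[_]; rewrite mem_PmaxE // => /and3P[].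
rewrite -(sum_mem_seq _ (subs_uniq (rev_enum_uniq k)) Pl_uniq Pl_subs).
have E0 : (fun n => \sum_(p <- subs S) pi_dot (vterm p n)) =1 pi_dot \o scaled_visits.
  by move=> n; rewrite /= visits_expansion pi_dot_sum.
apply: (asy_ext E0); rewrite big_seq.
have E1 : (fun n => \sum_(p <- subs S | p \in subs S) pi_dot (vterm p n)) =1
  (fun n => \sum_(p <- subs S) pi_dot (vterm p n)) by move=> n; rewrite -big_seq.
apply: (asy_ext E1); apply: asy_big => p pS.
have zero : (forall n, vterm p n = 0) -> asy hm.+1 (fun n => pi_dot (vterm p n)) 0.
  move=> z; apply: asy_ext (asy0 _) => n; rewrite z.
  by rewrite /pi_dot big1 // => t _; rewrite mxE mulr0.
rewrite mem_filter mem_PmaxE // pS /=; have [lp|lp] := boolP (l \in p); last first.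
  by apply: zero => n; rewrite (visit_term_notin Q r kernel_proj).
have p0 : p != [::] by case: (p) lp.
rewrite p0 /=; have [pl|pl] := boolP (linked link p); last first.
  by apply: zero => n; rewrite (unlinked_visit r proj_kernel kernel_proj l Es unlinked_proj).
have up : uniq p by move: pS; rewrite mem_subs => /subseq_uniq; apply; exact: rev_enum_uniq.
have H := pi_dot_asy (visit_term_asyv (Q := Q) (rho := r) (Es := Es) kernel_proj kernel_asy top_l up lp).
case: eqP => [ph|/eqP ph] /=; first by rewrite -ph.
by apply: (asy_lt (h' := hm.+1) H); rewrite ltnS ltn_neqAle ph count_le_hplus_max.
Qed.

Lemma alpha_path_cons i j q : alpha_path Q rho v [:: i, j & q] =
  alpha_blk Q rho v (Qblk blk Q i j *m v j) * alpha_path Q rho v (j :: q).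
Proof. by []. Qed.

(** The rank-one limits produce the numbers u_i x, which [Vminus_coef] identifies with the alpha
    coefficients. *)
Lemma path_coefE p : p != [::] ->
  path_coef p = alpha_path Q rho v p * \prod_(i <- p) rate i.
Proof.
have alphaE i (x : 'cV_(#|Iset blk i|)) : alpha_blk Q rho v x = (u i *m x) 0 0.
  exact: Vminus_coef (pQ i) (lu i).
elim: p => [//|i [|j q] IH] _.
  rewrite big_seq1 /= alphaE mulrC; congr (_ * _); rewrite -mulmxA; congr ((_ *m _) 0 0).
  by apply/matrixP => b t; rewrite tr_incl_mul !mxE.
rewrite path_coef_cons IH // [in RHS]big_cons.
rewrite alpha_path_cons alphaE QblkE !mulmxA; ring.
Qed.

(** Each top block contributes 1/r. On maximal paths this is the common factor r^-hm, which cancels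
    in the quotient. *)
Lemma rate_prod p : rho_path rho p = r ->
  \prod_(i <- p) rate i = Hminus_prod rho p * r^-1 ^+ count top p.
Proof.
rewrite /Hminus_prod => ->; elim: p => [|i p IH]; first by rewrite !big_nil mulr1.
rewrite !big_cons IH /rate /=; case: ifPn => [/eqP ti|ti].
  by rewrite ti ltxx add1n exprS mulrCA.
by rewrite topN // add0n mulrA.
Qed.

Lemma pi_dot_path_const p : (0 < hm)%N -> p \in Pm ->
  pi_dot (path_const p) = r^-1 ^+ hm * path_weight Q rho v pi p.
Proof.
move=> hm0 pP; have := pP; rewrite mem_PmaxE // => /and4P[p0 _ _ /eqP ph].
have pr : rho_path rho p = r by apply: rho_path_max; rewrite ph.
case: p pP p0 ph pr => // i q _ p0 ph pr.
rewrite (path_constE Q kernel_limE).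
rewrite pi_dotZ path_coefE // rate_prod // ph pi_dot_incl /path_weight.
by rewrite mulrAC [RHS]mulrC -!mulrA; congr (_ * _); rewrite mulrCA.
Qed.

Lemma pi_dot_visit_const p : (0 < hm)%N -> p \in Pl ->
  pi_dot (visit_const p) = u l 0 a * v l a 0 * (r^-1 ^+ hm * path_weight Q rho v pi p).
Proof.
move=> hm0; rewrite mem_filter => /andP[lp pP]; rewrite -pi_dot_path_const //.
have cE : ((u l *m (J l)^T) *m Es *m (J l *m v l)) 0 0 = u l 0 a * v l a 0.
  rewrite delta_incl -!mulmxA (mulmxA (J l)^T (J l) (v l)) tr_incl_incl mul1mx.
  rewrite (mulmxA (J l)^T (J l)) tr_incl_incl mul1mx mxE (bigD1 a) //= big1 => [|b ba].
    by rewrite addr0 mxE (bigD1 a) //= big1 ?addr0 => [|b ba];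
      rewrite !mxE ?eqxx ?mul1r // (negbTE ba) andbF mul0r.
  by rewrite mxE big1 ?mulr0 // => c _; rewrite !mxE (negbTE ba) mul0r.
have grho : rate l * r = 1 by rewrite /rate top_l mulVf ?r_neq0.
case: p lp pP => // i q lp _.
rewrite (visit_constE Q kernel_limE grho cE) //.
rewrite (path_constE Q kernel_limE).
by rewrite !pi_dotZ mulrA.
Qed.

(** * Nonnegativity of the path weights and the limit of the quotient *)

Hypothesis Q0 : forall s t, 0 <= Q s t.
Hypothesis pi0 : forall t, 0 <= pi t.

Lemma alpha_blk_ge0 i (x : 'cV_(#|Iset blk i|)) :
  (forall b, 0 <= x b 0) -> 0 <= alpha_blk Q rho v x.
Proof.
move=> x0; rewrite /alpha_blk (Vminus_coef _ (pQ i) (lu i)) mxE sumr_ge0 // => b _.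
by rewrite mulr_ge0 // (left_perron_ge0 _ (pQ i) (lu i)).
Qed.

Lemma v_ge0 i b : 0 <= v i b 0. Proof. by apply: ltW; case: (pQ i). Qed.

Lemma alpha_path_ge0 p : 0 <= alpha_path Q rho v p.
Proof.
elim: p => [//|i [|j q] IH]; first by apply: alpha_blk_ge0 => b; rewrite mxE.
apply: mulr_ge0 => //; apply: alpha_blk_ge0 => b; rewrite mxE sumr_ge0 // => c _.
by rewrite mulr_ge0 ?v_ge0 // mxE.
Qed.

Lemma pi_v_ge0 i : 0 <= pi_v pi (v i).
Proof. by apply: sumr_ge0 => b _; rewrite mulr_ge0 ?v_ge0. Qed.

Lemma Hminus_prod_gt0 p : 0 < Hminus_prod rho p.
Proof.
rewrite /Hminus_prod; elim/big_rec: _ => [//|i x lt_i x0]; rewrite mulr_gt0 // invr_gt0 subr_gt0.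
apply: (lt_le_trans lt_i); apply: bigmax_le => [|j _]; last exact: rho_le_max.
exact: ltW r_gt0.
Qed.

Lemma path_weight_ge0 p : 0 <= path_weight Q rho v pi p.
Proof.
case: p => [//|i q]; rewrite /path_weight !mulr_ge0 ?alpha_path_ge0 ?pi_v_ge0 //.
exact: ltW (Hminus_prod_gt0 _).
Qed.

Lemma sum_path_weight_gt0 i q : i :: q \in Pm -> alpha_path Q rho v (i :: q) != 0 ->
  pi_v pi (v i) != 0 -> 0 < \sum_(p <- Pm) path_weight Q rho v pi p.
Proof.
move=> iP a0 p0; rewrite (bigD1_seq _ iP Pmax_uniq) /= ltr_pwDl //; last first.
  by apply: sumr_ge0 => p _; exact: path_weight_ge0.
have al0 : 0 < alpha_path Q rho v (i :: q) by rewrite lt_neqAle eq_sym a0 alpha_path_ge0.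
have pv0 : 0 < pi_v pi (v i) by rewrite lt_neqAle eq_sym p0 pi_v_ge0.
by rewrite /path_weight mulr_gt0 ?Hminus_prod_gt0 // mulr_gt0.
Qed.

Lemma visit_ratio_cvg i q : Pl != [::] -> i :: q \in Pm ->
  alpha_path Q rho v (i :: q) != 0 -> pi_v pi (v i) != 0 ->
  (fun n => pi_dot (vv n) / n.+1%:R / pi_dot (Q ^+ n *m const_mx 1)) @ \oo -->
    u l 0 a * v l a 0 * hm%:R^-1 *
    ((\sum_(p <- Pl) path_weight Q rho v pi p) / (\sum_(p <- Pm) path_weight Q rho v pi p)).
Proof.
move=> Pl0 iP a0 p0; have hm0 := hplus_max_gt0 Pl0.
have D0 := sum_path_weight_gt0 iP a0 p0.
have rh0 : r^-1 ^+ hm != 0 by rewrite expf_neq0 // invr_eq0 r_neq0.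
have num := visits_asy hm0; have den := tail_asy hm0.
rewrite big_seq (eq_bigr _ (fun p => pi_dot_visit_const hm0)) -big_seq -!mulr_sumr in num.
rewrite big_seq (eq_bigr _ (fun p => pi_dot_path_const hm0)) -big_seq -!mulr_sumr in den.
(* [asy_ratio] is applied with [h = hm - 1], which makes its factor 1/(h+1) equal to 1/hm. *)
rewrite -(prednK hm0) in num den rh0 *.
have H := asy_ratio num den (mulf_neq0 rh0 (lt0r_neq0 D0)).
set N := \sum_(p <- Pl) _ in H *; set D := \sum_(p <- Pm) _ in D0 H *.
have E1 : hm.-1.+1%:R^-1 * (u l 0 a * v l a 0 * (r^-1 ^+ hm.-1.+1 * N) / (r^-1 ^+ hm.-1.+1 * D)) =
    u l 0 a * v l a 0 * hm.-1.+1%:R^-1 * (N / D).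
  by rewrite -mulrA -mulf_div divff // mul1r; ring.
rewrite -E1; apply: (cvg_ext _ H) => n /=.
have rn0 : r^-1 ^+ n.+1 != 0 by rewrite expf_neq0 // invr_eq0 r_neq0.
rewrite /scaled_visits /scaled_tail !pi_dotZ invfM.
set c := r^-1 ^+ n.+1; set A := pi_dot (vv n); set B := pi_dot _.
transitivity (c / c * (A / n.+1%:R / B)); first by ring.
by rewrite divff // mul1r.
Qed.

End BlockAsymptotics.

Unset Implicit Arguments.

Theorem theorem3p20
  (R : realType) (d : nat) (P : 'M[R]_d.+1) (pi : 'I_d -> R)
  (k : nat) (blk : 'I_d -> 'I_k) (rho : 'I_k -> R)
  (v : forall i : 'I_k, 'cV[R]_(#|Iset blk i|))
  (l : 'I_k) (u : 'rV[R]_(#|Iset blk l|)) :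
  (2 <= d)%N ->
  (* P is stochastic of the form [[1, 0], [R, Q]] with R, Q <> 0 *)
  (forall a b, 0 <= P a b) ->
  (forall a, \sum_b P a b = 1) ->
  P ord0 ord0 = 1 ->
  (forall b, b != ord0 -> P ord0 b = 0) ->
  Rof P != 0 ->
  Qof P != 0 ->
  (* all (complex) eigenvalues of Q have modulus < 1 *)
  (forall lam : R[i], is_eigenvalue (Qof P) lam -> `|lam| < 1) ->
  (* pi is a probability distribution on {1,...,d} *)
  (forall s, 0 <= pi s) ->
  \sum_s pi s = 1 ->
  (* Frobenius normal form: blocks I_1,...,I_k are consecutive intervals *)
  (forall s t : 'I_d, (s <= t)%N -> (blk s <= blk t)%N) ->
  (forall i, exists s, blk s = i) ->
  (forall s t, (blk s < blk t)%N -> Qof P s t = 0) ->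
  (forall i, exists m0, forall m, (m0 <= m)%N ->
     forall a b, 0 < (Qblk blk (Qof P) i i ^+ m) a b) ->
  (* rho_i Perron-Frobenius eigenvalue, v_i normed positive right eigenvector *)
  (forall i, (forall a, 0 < v i a 0) /\
             Qblk blk (Qof P) i i *m v i = rho i *: v i /\
             \sum_a v i a 0 = 1) ->
  (* (A1) *)
  (forall i, rho i < rho_max rho -> is_scalar_mx (Qblk blk (Qof P) i i)) ->
  (* (A2) *)
  (exists th i1 th', th = i1 :: th' /\ th \in Pmax blk (Qof P) rho /\
       alpha_path (Qof P) rho v th != 0 /\ pi_v pi (v i1) != 0) ->
  (* the block l *)
  rho l = rho_max rho ->
  Pmax_l blk (Qof P) rho l != [::] ->
  (* u^(l) positive left eigenvector of Q_ll, normalised by u^(l) v^(l) = 1 *)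
  (forall a, 0 < u 0 a) ->
  u *m Qblk blk (Qof P) l l = rho l *: u ->
  (u *m v l) 0 0 = 1 ->
  forall a : 'I_#|Iset blk l|,
    (fun n => cond_occupation P pi (lift ord0 (enum_val a)) n) @ \oo -->
      u 0 a * v l a 0 * (hplus_max blk (Qof P) rho)%:R^-1 *
      ((\sum_(th <- Pmax_l blk (Qof P) rho l) path_weight (Qof P) rho v pi th) /
       (\sum_(th <- Pmax blk (Qof P) rho) path_weight (Qof P) rho v pi th)).
Proof.
move=> _ P0 _ _ _ _ _ _ pi0 _ _ _ low evpos vP scal [th [i1 [q [-> [thP [al0 pv0]]]]]] rl Pl0 u0 uQ uv a.
have Q0 s t : 0 <= Qof P s t by rewrite mxE.
have pQ i : perron (Qblk blk (Qof P) i i) (rho i) (v i).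
  have [v0 [Qv v1]] := vP i; split=> // b c; by rewrite mxE.
have lul : left_perron (Qblk blk (Qof P) l l) (rho l) (v l) u by [].
(* Left eigenvectors are given for block [l] only; they are chosen for all blocks, and uniqueness
   identifies the one for [l] with [u]. *)
pose U i := projT1 (cid (left_perron_exists (pQ i))).
have lu i : left_perron (Qblk blk (Qof P) i i) (rho i) (v i) (U i).
  exact: projT2 (cid (left_perron_exists (pQ i))).
have Ul : u = U l by exact: left_perron_uniq (pQ l) lul (lu l).
have := visit_ratio_cvg low pQ lu scal rl (a := a) (vv := visit_vec P (enum_val a)) _ _ Q0 pi0
  Pl0 thP al0 pv0.
rewrite Ul => H; apply: (cvg_ext _ (H _ _)) => [n||n] //; last by rewrite /= addr0 expr0 mul1mx.
have wE x : path_prob P pi x = traj_weight P (init_law pi) x by [].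
have piE t : init_law pi (lift ord0 t) = pi t by rewrite /init_law liftK.
rewrite /cond_occupation.
have -> : \sum_(x : {ffun 'I_n.+1 -> 'I_d.+1} | not_absorbed x) path_prob P pi x =
    pi_dot pi (Qof P ^+ n *m const_mx 1).
  by rewrite -[LHS]/(survival P (init_law pi) n) survivalE; apply: eq_bigr => t _; rewrite piE.
congr (_ / _).
have -> : pi_dot pi (visit_vec P (enum_val a) n) = visits P (init_law pi) (lift ord0 (enum_val a)) n.
  by rewrite visitsE; apply: eq_bigr => t _; rewrite piE.
by rewrite /visits mulr_suml; apply: eq_bigr => x _; rewrite mulrA.
Qed.
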